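(* Let $X$ be an isotropic log-concave random vector in $\mathbb{R}^d$ and let $Z\sim\mathcal{N}(0,I_d)$ be a standard Gaussian random vector independent of $X$. Let $\Delta(X)=\frac{h(Z_X)-h(X)}{d}$, where $Z_X$ is a centered Gaussian random vector in $\mathbb{R}^d$ having the same covariance matrix as $X$. Then for any contraction $T:\mathbb{R}^d\to\mathbb{R}^d$, $$N(X+Z)\ge N(T(X)+Z)+\Bigl(1-\bigl(e^{\Delta(X)}\,\mathrm{Lip}(T)\bigr)^2\Bigr)N(X).$$
   Context: A contraction is a $1$-Lipschitz map for the Euclidean norm; $\mathrm{Lip}(T)$ is the Lipschitz constant of $T$ for the Euclidean norm. A random vector is log-concave if it has a density of the form $e^{-\phi}$ with $\phi:\mathbb{R}^d\to(-\infty,\infty]$ convex. It is isotropic if its covariance matrix is a scalar multiple of the identity matrix (no centering is required). For a random vector $Y$ in $\mathbb{R}^d$ with density $f$, $h(Y)=-\int f\log f$ is the Shannon–Boltzmann entropy (natural logarithm) and $N(Y)=e^{2h(Y)/d}$ is the entropy power. *)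

(* Defs.v *)
From HB Require Import structures.
From mathcomp Require Import all_boot all_order all_algebra.
From mathcomp Require Import all_classical all_reals all_analysis.

Set Implicit Arguments.
Unset Strict Implicit.
Unset Printing Implicit Defensive.

Import Order.TTheory GRing.Theory Num.Theory.
Import numFieldNormedType.Exports.

Local Open Scope classical_set_scope.
Local Open Scope ring_scope.

Definition measure_rV_display : measure_display -> measure_display.
Proof. exact. Qed.

(* Row vectors carry the product sigma-algebra (for T := R, the Borel one). *)
Section measurable_rV.
Context {d : measure_display} {T : measurableType d}.
Variable n : nat.

Let coords : 'I_n -> 'rV[T]_n -> T := fun i v => v ord0 i.

Let rV_set0 : g_sigma_preimage coords set0.
Proof. exact: sigma_algebra0. Qed.

Let rV_setC A : g_sigma_preimage coords A -> g_sigma_preimage coords (~` A).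
Proof. exact: sigma_algebraC. Qed.

Let rV_bigcup (F : _^nat) : (forall i, g_sigma_preimage coords (F i)) ->
  g_sigma_preimage coords (\bigcup_i (F i)).
Proof. exact: sigma_algebra_bigcup. Qed.

HB.instance Definition _ := @isMeasurable.Build (measure_rV_display d)
  'rV[T]_n (g_sigma_preimage coords) rV_set0 rV_setC rV_bigcup.

Lemma measurable_rV_coord (i : 'I_n) :
  measurable_fun [set: 'rV[T]_n] (fun v : 'rV[T]_n => v ord0 i).
Proof.
move=> _ Y mY; rewrite setTI; apply: sub_sigma_algebra => /=.
rewrite -bigcup_seq/=; exists i => /=; first by rewrite mem_index_enum.
by exists Y => //; rewrite setTI.
Qed.

Lemma measurable_fun_rVP (d' : measure_display) (T' : measurableType d')
    (f : T' -> 'rV[T]_n) :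
  measurable_fun [set: T'] f <->
  forall i, measurable_fun [set: T'] (fun x => f x ord0 i).
Proof.
split=> [mf i|mf].
  exact: (measurableT_comp (measurable_rV_coord i) mf).
suff sub : (measurable : set (set 'rV[T]_n)) `<=`
    [set A | measurable (f @^-1` A)].
  by move=> _ A mA; rewrite setTI; exact: sub.
apply: smallest_sub.
  split=> [|A /= mA|F /= mF].
  - by rewrite /= preimage_set0.
  - by rewrite setTD preimage_setC; exact: measurableC.
  - by rewrite preimage_bigcup; exact: bigcupT_measurable.
rewrite -bigcup_seq => A [i _ [B mB <-]] /=.
by rewrite setTI -[X in measurable X]setTI; exact: (mf i measurableT B mB).
Qed.

End measurable_rV.

Section cons_rV.
Context {R : realType}.
Variable n : nat.

(* measurableTypeR R, the carrier of lebesgue_measure, is R with the Borel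
   sigma-algebra under another display. *)
Definition cons_rV (p : measurableTypeR R * 'rV[R]_n) : 'rV[R]_n.+1 :=
  row_mx (p.1 : R)%:M p.2 : 'rV[R]_(1 + n).

Definition uncons_rV (v : 'rV[R]_n.+1) : measurableTypeR R * 'rV[R]_n :=
  (v ord0 ord0, \row_j v ord0 (lift ord0 j)).

Lemma cons_rV0 p : cons_rV p ord0 ord0 = p.1.
Proof.
have -> : ord0 = lshift n (ord0 : 'I_1) :> 'I_(1 + n) by exact: val_inj.
by rewrite [LHS](@row_mxEl R 1 1 n (p.1 : R)%:M p.2) mxE eqxx.
Qed.

Lemma cons_rVS p (j : 'I_n) : cons_rV p ord0 (lift ord0 j) = p.2 ord0 j.
Proof.
have -> : lift ord0 j = rshift 1 j :> 'I_(1 + n) by exact: val_inj.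
exact: (@row_mxEr R 1 1 n (p.1 : R)%:M p.2).
Qed.

Lemma cons_rVK : cancel cons_rV uncons_rV.
Proof.
move=> [x v]; rewrite /uncons_rV cons_rV0; congr (_, _).
by apply/rowP => j; rewrite mxE cons_rVS.
Qed.

Lemma measurable_cons_rV : measurable_fun [set: measurableTypeR R * 'rV[R]_n] cons_rV.
Proof.
apply/measurable_fun_rVP => i.
case: (unliftP ord0 i) => [j ->|->].
  under eq_fun do rewrite cons_rVS.
  exact: measurableT_comp (measurable_rV_coord j) measurable_snd.
by under eq_fun do rewrite cons_rV0; exact: measurable_fst.
Qed.

Lemma measurable_uncons_rV : measurable_fun [set: 'rV[R]_n.+1] uncons_rV.
Proof.
apply: measurable_fun_pair; first exact: measurable_rV_coord.
apply/measurable_fun_rVP => j; under eq_fun do rewrite mxE.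
exact: measurable_rV_coord.
Qed.

End cons_rV.

Section lebesgue_cons.
Local Open Scope ereal_scope.
Context {R : realType}.
Variables (n : nat) (mu : {sigma_finite_measure set 'rV[R]_n -> \bar R}).

Definition lebesgue_cons : set 'rV[R]_n.+1 -> \bar R :=
  pushforward (@lebesgue_measure R \x mu) (@cons_rV R n).

Let mcons A : measurable A -> measurable (@cons_rV R n @^-1` A).
Proof.
by move=> mA; rewrite -[X in measurable X]setTI; exact: measurable_cons_rV.
Qed.

Let lebesgue_cons0 : lebesgue_cons set0 = 0.
Proof. by rewrite /lebesgue_cons /pushforward preimage_set0 measure0. Qed.

Let lebesgue_cons_ge0 A : 0 <= lebesgue_cons A.
Proof. exact: (measure_ge0 (lebesgue_measure \x mu)). Qed.

Let lebesgue_cons_sigma_additive : semi_sigma_additive lebesgue_cons.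
Proof.
move=> F mF tF mUF; rewrite /lebesgue_cons /pushforward preimage_bigcup.
apply: measure_semi_sigma_additive => [k||].
- exact: mcons.
- apply/trivIsetP => /= i j _ _ ij; rewrite -preimage_setI.
  by move/trivIsetP : tF => /(_ _ _ _ _ ij) ->//; rewrite preimage_set0.
- by rewrite -preimage_bigcup; exact: mcons.
Qed.

HB.instance Definition _ := isMeasure.Build _ _ _ lebesgue_cons
  lebesgue_cons0 lebesgue_cons_ge0 lebesgue_cons_sigma_additive.

Let lebesgue_cons_sigma_finite : sigma_finite setT lebesgue_cons.
Proof.
have /sigma_finiteP[F [FT ndF Foo]] := sigma_finiteT (@lebesgue_measure R).
have /sigma_finiteP[G [GT ndG Goo]] := sigma_finiteT mu.
exists (fun k => @uncons_rV R n @^-1` (F k `*` G k)).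
  rewrite -preimage_bigcup -(_ : setT = \bigcup_k (F k `*` G k)) ?preimage_setT//.
  rewrite -setXTT FT GT predeqE => -[x y]; split; last first.
    by move=> [k _ []/= ? ?]; split; exists k.
  move=> [/= [k _ Fkx] [l _ Gly]]; exists (maxn k l) => //; split.
  - by move: x Fkx; exact/subsetPset/ndF/leq_maxl.
  - by move: y Gly; exact/subsetPset/ndG/leq_maxr.
move=> k; have [mF Fk] := Foo k; have [mG Gk] := Goo k; split.
  rewrite -[X in measurable X]setTI; apply: measurable_uncons_rV => //.
  exact: measurableX.
rewrite /lebesgue_cons /pushforward -comp_preimage.
rewrite (_ : _ \o _ = id); last by apply/funext/cons_rVK.
by rewrite preimage_id product_measure1E// lte_mul_pinfty// ge0_fin_numE.
Qed.

HB.instance Definition _ := Measure_isSigmaFinite.Build _ _ _ lebesgue_cons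
  lebesgue_cons_sigma_finite.

End lebesgue_cons.

(* Lebesgue measure on R^n, as the n-fold product of Lebesgue measure on R. *)
Fixpoint lebesgue_rV (R : realType) (n : nat) :
    {sigma_finite_measure set 'rV[R]_n -> \bar R} :=
  if n is m.+1 then lebesgue_cons (lebesgue_rV R m) else \d_(0 : 'rV[R]_0).

Lemma lebesgue_rV_box (R : realType) (n : nat)
    (A : 'I_n -> set (measurableTypeR R)) : (forall i, measurable (A i)) ->
  lebesgue_rV R n [set v | forall i, A i (v ord0 i)] =
  (\prod_(i < n) lebesgue_measure (A i))%E.
Proof.
elim: n A => [|n IHn] A mA.
  by rewrite big_ord0 [LHS]diracE mem_set// => -[].
have mB : measurable [set v : 'rV[R]_n | forall i, A (lift ord0 i) (v ord0 i)].
  rewrite (_ : [set _ | _] = \bigcap_(i in [set: 'I_n])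
      ((fun v : 'rV[R]_n => v ord0 i) @^-1` A (lift ord0 i))).
    apply: fin_bigcap_measurable => // i _; rewrite -[X in measurable X]setTI.
    by apply: measurable_rV_coord => //; exact: mA.
  by apply/seteqP; split => v /= vA i; [move=> _; exact: vA|exact: vA].
rewrite big_ord_recl -(IHn (fun i => A (lift ord0 i)))//.
rewrite -(product_measure1E lebesgue_measure (lebesgue_rV R n))//.
rewrite /= /lebesgue_cons /pushforward; congr (_ _).
apply/seteqP; split => p /= => [pA|[p1 p2] i].
  split=> [|i]; first by have := pA ord0; rewrite cons_rV0.
  by have := pA (lift ord0 i); rewrite cons_rVS.
by case: (unliftP ord0 i) => [j ->|->]; rewrite ?cons_rVS ?cons_rV0.
Qed.

Section euclidean.
Context {R : realType}.
Variable d : nat.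
Implicit Type T : 'rV[R]_d -> 'rV[R]_d.

(* The library norm on 'rV[R]_d is the sup norm. *)
Definition enorm (x : 'rV[R]_d) : R := Num.sqrt (\sum_(i < d) x ord0 i ^+ 2).

Definition elipschitz (k : R) T : Prop :=
  forall x y, enorm (T x - T y) <= k * enorm (x - y).

Definition contractive T : Prop := elipschitz 1 T.

(* Junk value inf set0 = 0 when T is not Lipschitz. *)
Definition Lip T : R := inf [set k | 0 <= k /\ elipschitz k T].

End euclidean.

Section random_vectors.
Context {dO : measure_display} {Omega : measurableType dO} {R : realType}.
Variables (P : probability Omega R) (d : nat).
Implicit Types (X Y : Omega -> 'rV[R]_d) (f : 'rV[R]_d -> R).

Definition has_density Y f : Prop :=
  [/\ measurable_fun [set: 'rV[R]_d] f,
      forall x, 0 <= f x &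
      forall A, measurable A ->
        P (Y @^-1` A) = (\int[lebesgue_rV R d]_(x in A) (f x)%:E)%E].

(* +oo * 0 = 0 in \bar R, so t = 0 and t = 1 impose nothing. *)
Definition econvex (phi : 'rV[R]_d -> \bar R) : Prop :=
  forall (t : R) (x y : 'rV[R]_d), 0 <= t <= 1 ->
    (phi (t *: x + (1 - t) *: y)%R <= t%:E * phi x + (1 - t)%:E * phi y)%E.

Definition log_concave X : Prop :=
  exists phi : 'rV[R]_d -> \bar R,
    [/\ forall x, phi x != -oo%E, econvex phi &
        has_density X (fun x => fine (expeR (- phi x)%E))].

(* fine is harmless for log-concave X, all of whose moments are finite. *)
Definition covmx X : 'M[R]_d :=
  \matrix_(i, j) fine (covariance P (fun w => X w ord0 i)
                                    (fun w => X w ord0 j)).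

Definition isotropic X : Prop := exists s : R, covmx X = s%:M.

Definition posdefmx (S : 'M[R]_d) : Prop :=
  S^T = S /\ forall v : 'rV[R]_d, v != 0 -> 0 < (v *m S *m v^T) ord0 ord0.

Definition gaussian_pdf (m : 'rV[R]_d) (S : 'M[R]_d) (x : 'rV[R]_d) : R :=
  (Num.sqrt ((2 * pi) ^+ d * \det S))^-1 *
  expR (- ((x - m) *m invmx S *m (x - m)^T) ord0 ord0 / 2).

(* Y ~ N(m, S), nondegenerate *)
Definition gaussian_vector Y (m : 'rV[R]_d) (S : 'M[R]_d) : Prop :=
  posdefmx S /\ has_density Y (gaussian_pdf m S).

Definition independent X Y : Prop :=
  forall A B, measurable A -> measurable B ->
    P (X @^-1` A `&` Y @^-1` B) = (P (X @^-1` A) * P (Y @^-1` B))%E.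

(* Some density of Y; densities agree almost everywhere, so entropy below does
   not depend on the choice. Junk value 0 when Y has no density. *)
Definition density Y : 'rV[R]_d -> R := xget (cst 0) [set f | has_density Y f].

(* ln 0 = 0, hence 0 * ln 0 = 0. *)
Definition entropy Y : \bar R :=
  (- \int[lebesgue_rV R d]_x (density Y x * ln (density Y x))%:E)%E.

Definition entropy_power Y : \bar R := expeR ((2 / d%:R)%:E * entropy Y)%E.

End random_vectors.

(* Delta(X), where G is the Gaussian vector Z_X, possibly living on another
   probability space *)
Definition entropy_gap (R : realType) (d : nat)
    (dO dO' : measure_display)
    (Omega : measurableType dO) (Omega' : measurableType dO')
    (P : probability Omega R) (P' : probability Omega' R)
    (G : Omega' -> 'rV[R]_d) (X : Omega -> 'rV[R]_d) : \bar R :=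
  ((d%:R^-1)%:E * (entropy P' G - entropy P X))%E.

(* Main.v *)
(* Write gamma for the standard Gaussian density, q = f * gamma for the density of
   X + Z, and l = N(X) / (N(X) + 2 pi e). Since X is isotropic, N(Z_X) = 2 pi e s
   with cov X = s I, and the Gaussian maximizes entropy under a second moment
   bound, so N(T(X) + Z) <= 2 pi e (1 + Lip(T)^2 s); hence the theorem reduces to
   the entropy power inequality N(X + Z) >= N(X) + 2 pi e.

   The latter is proved by transport. A Knothe (triangular) map u pushes f to
   gamma; let J be the Jacobian of x |-> sqrt l x + sqrt (1 - l) u(x). By change
   of variables the kernel
     k(x, z) = q(x + z) gamma(sqrt l z - sqrt (1 - l) u(x)) J(x)
   has total mass at most 1, so ln t <= t - 1 applied to k / (f gamma) bounds
   - \int q ln q from below, and the concavity of ln bounds ln J in terms of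
   ln f - ln gamma(u). This gives
     h(X + Z) >= l h(X) + (1 - l) h(Z) - d (l ln l + (1 - l) ln (1 - l)) / 2. *)
Require Import Defs.
From HB Require Import structures.
From mathcomp Require Import all_boot all_order all_algebra.
From mathcomp Require Import all_classical all_reals all_analysis.
From mathcomp Require Import measurable_realfun ring lra.

Set Implicit Arguments.
Unset Strict Implicit.
Unset Printing Implicit Defensive.

Import Order.TTheory GRing.Theory Num.Theory.
Import numFieldNormedType.Exports.

Local Open Scope classical_set_scope.
Local Open Scope ring_scope.

(** The density [f] has no regularity, so an exact change of variables is out of reach. In one
    dimension, however, the transported kernel is almost everywhere the derivative of a
    nondecreasing function with values in [0, 1]; Fatou's lemma then bounds its integral by 1, and
    an upper bound on the mass is the direction the argument needs. The triangular form of [u]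
    carries this over to [d] dimensions by Tonelli. The bound on ln (k / (f gamma)) contains
    |u(x)|^2, of which no moment is computed. The pair sqrt l z - sqrt (1 - l) u, sqrt (1 - l) z +
    sqrt l u is a rotation of (z, u), and once z is integrated out at fixed x, all terms in |u(x)|^2
    cancel against the one in ln gamma(u(x)). Hence the order of integration: z before x.
    Log-concavity bounds [f], which makes f ln f integrable and h(X) finite. Since e^(2 Delta(X))
    N(X) = N(Z_X), the subtracted term is 2 pi e Lip(T)^2 s, exactly the part of the bound on N(T(X)
    + Z) that depends on T. The value of l maximizes the lower bound on h(X + Z). *)

(** * Tonelli and affine substitution for Lebesgue measure on row vectors *)

Section lebesgue_rV_integration.
Context {R : realType}.
Local Notation leb := (@lebesgue_measure R).
Local Open Scope ereal_scope.

Lemma measurable_rV0 (d : measure_display) (T : measurableType d) (f : 'rV[R]_0 -> T) :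
  measurable_fun [set: 'rV[R]_0] f.
Proof.
have -> : f = cst (f 0%R) by apply/funext => x; rewrite (thinmx0 x).
exact: measurable_cst.
Qed.

Lemma ge0_integral_cons n (G : 'rV[R]_n.+1 -> \bar R) :
  measurable_fun [set: 'rV[R]_n.+1] G -> (forall x, 0 <= G x) ->
  \int[lebesgue_rV R n.+1]_x G x =
  \int[lebesgue_rV R n]_v \int[leb]_x G (cons_rV (x, v)).
Proof.
move=> mG G0.
transitivity (\int[pushforward (leb \x lebesgue_rV R n) (@cons_rV R n)]_x G x) => //.
rewrite ge0_integral_pushforward//; last exact: measurable_cons_rV.
rewrite preimage_setT fubini_tonelli2//=.
exact: measurableT_comp mG (@measurable_cons_rV R n).
Qed.

Lemma ge0_integral_cons' n (G : 'rV[R]_n.+1 -> \bar R) :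
  measurable_fun [set: 'rV[R]_n.+1] G -> (forall x, 0 <= G x) ->
  \int[lebesgue_rV R n.+1]_x G x =
  \int[leb]_x \int[lebesgue_rV R n]_v G (cons_rV (x, v)).
Proof.
move=> mG G0; rewrite ge0_integral_cons//.
rewrite -(fubini_tonelli (fun p => G (cons_rV p)))//.
exact: measurableT_comp mG (@measurable_cons_rV R n).
Qed.

Lemma integral_rV0 (G : 'rV[R]_0 -> \bar R) :
  \int[lebesgue_rV R 0]_x G x = G 0%R.
Proof.
rewrite /= integral_dirac//; last exact: measurable_rV0.
by rewrite diracE mem_set// mul1e.
Qed.

Lemma cons_rV_affine n (a x y : R) (v w : 'rV[R]_n) :
  (a *: cons_rV (x, v) + cons_rV (y, w) = cons_rV (a * x + y, a *: v + w))%R.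
Proof.
apply/rowP => i; rewrite [LHS]mxE [in LHS]mxE.
by case: (unliftP ord0 i) => [j ->|->]; rewrite ?cons_rVS ?cons_rV0 ?mxE.
Qed.

Lemma uncons_rVK n (v : 'rV[R]_n.+1) : cons_rV (uncons_rV v) = v.
Proof.
apply/rowP => i.
by case: (unliftP ord0 i) => [j ->|->]; rewrite ?cons_rVS ?cons_rV0/= ?mxE.
Qed.

Lemma measurable_affine (a b : R) :
  measurable_fun [set: measurableTypeR R] (fun x : R => (a * x + b)%R : measurableTypeR R).
Proof. by apply: measurable_funD => //; exact: measurable_funM. Qed.

(** The right side is again a measure in [A], so uniqueness of Lebesgue measure reduces the identity
    to the intervals []c, d]]. *)
Lemma lebesgue_measure_affine (a b : R) (A : set R) : a != 0%R -> measurable A ->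
  leb A = `|a|%:E * pushforward leb (fun x : R => (a * x + b)%R : measurableTypeR R) A.
Proof.
move=> a0 mA; pose phi := fun x : R => (a * x + b)%R : measurableTypeR R.
have mphi := measurable_affine a b.
pose m : {measure set (measurableTypeR R) -> \bar R} :=
  mscale (NngNum (normr_ge0 a)) (@pushforward _ _ _ _ R leb phi).
rewrite -[RHS]/(m mphi A); apply: lebesgue_measure_unique => // _ [[c d]] _ <-.
transitivity (`|a|%:E * leb ((fun x : R => (a * x + b)%R) @^-1` `]c, d]%classic)) => //.
rewrite [LHS]lebesgue_measure_itv/=.
(* [lt_total] lists [a < 0] first, so [a_lt0] names [0 < a], the case treated first. For negative
   [a] the preimage of []c, d]] is closed on the left and open on the right, which does not affect
   its length. *)
have [a_gt0|a_lt0] := orP (lt_total a0); last first.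
  rewrite (_ : _ @^-1` _ = `]((c - b) / a)%R, ((d - b) / a)%R]%classic).
    rewrite lebesgue_measure_itv/= !lte_fin ltr_pM2r ?invr_gt0// ltrD2r.
    case: ifP => _; last by rewrite mule0.
    rewrite gtr0_norm// -!EFinD -EFinM; congr _%:E; field; exact: lt0r_neq0.
  apply/seteqP; split => x /=; rewrite !in_itv/= => /andP[].
    by rewrite ltr_pdivrMr// ler_pdivlMr// => ? ?; apply/andP; split; lra.
  by rewrite ltr_pdivrMr// ler_pdivlMr// => ? ?; apply/andP; split; lra.
rewrite (_ : _ @^-1` _ = `[((d - b) / a)%R, ((c - b) / a)%R[%classic).
  rewrite lebesgue_measure_itv/= !lte_fin ltr_nM2r ?invr_lt0// ltrD2r.
  case: ifP => _; last by rewrite mule0.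
  rewrite ltr0_norm// -!EFinD -EFinM; congr _%:E; field; exact: ltr0_neq0.
apply/seteqP; split => x /=; rewrite !in_itv/= => /andP[].
  by rewrite ltr_ndivlMr// ler_ndivrMr// => ? ?; apply/andP; split; lra.
by rewrite ltr_ndivlMr// ler_ndivrMr// => ? ?; apply/andP; split; lra.
Qed.

Lemma ge0_integral_affine1 (a b : R) (G : R -> \bar R) : a != 0%R ->
  measurable_fun [set: R] G -> (forall x, 0 <= G x) ->
  \int[leb]_x G x = `|a|%:E * \int[leb]_x G (a * x + b)%R.
Proof.
move=> a0 mG G0; pose phi := fun x : R => (a * x + b)%R : measurableTypeR R.
have mphi := measurable_affine a b.
pose p : {measure set (measurableTypeR R) -> \bar R} := @pushforward _ _ _ _ R leb phi.
pose m : {measure set (measurableTypeR R) -> \bar R} :=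
  mscale (NngNum (normr_ge0 a)) (p mphi).
transitivity (\int[m]_x G x).
  by apply: eq_measure_integral => A mA _; exact: lebesgue_measure_affine.
rewrite (ge0_integral_mscale (p mphi))//=.
by rewrite [X in _ * X](ge0_integral_pushforward mphi).
Qed.

Lemma measurable_affine_rV n (a : R) (b : 'rV[R]_n) :
  measurable_fun [set: 'rV[R]_n] (fun x : 'rV[R]_n => (a *: x + b)%R).
Proof.
apply/measurable_fun_rVP => i.
under eq_fun do rewrite !mxE.
apply: measurable_funD => //; apply: measurable_funM => //.
exact: measurable_rV_coord.
Qed.

(** The map acts separately on the first coordinate and on the rest ([cons_rV_affine]), so each step
    of the induction contributes one factor [|a|]. *)
Lemma ge0_integral_affine n (a : R) (b : 'rV[R]_n) (G : 'rV[R]_n -> \bar R) :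
  a != 0%R -> measurable_fun [set: 'rV[R]_n] G -> (forall x, 0 <= G x) ->
  \int[lebesgue_rV R n]_x G x =
  (`|a| ^+ n)%:E * \int[lebesgue_rV R n]_x G (a *: x + b)%R.
Proof.
move=> a0; elim: n => [|n IH] in b G * => mG G0.
  by rewrite !integral_rV0 expr0 mul1e; congr G; apply/rowP => -[].
have mC : measurable_fun setT (fun p => G (cons_rV p)).
  exact: measurableT_comp mG (@measurable_cons_rV R n).
rewrite ge0_integral_cons//.
pose b0 : R := (uncons_rV b).1; pose b' := (uncons_rV b).2.
have bE : b = cons_rV (b0, b') by rewrite -[LHS]uncons_rVK.
have mGv v : measurable_fun [set: measurableTypeR R] (fun x => G (cons_rV (x, v))).
  exact: measurable_fun_pair1 mC.
rewrite (IH b')//=; last 2 first.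
- exact: (measurable_fun_fubini_tonelli_G (fun p => G (cons_rV p))).
- by move=> v; exact: integral_ge0.
rewrite ge0_integral_cons//; last first.
  exact: measurableT_comp mG (@measurable_affine_rV n.+1 a b).
under [in LHS]eq_integral => v _.
  rewrite (ge0_integral_affine1 b0 a0)//; last exact: mGv.
  under eq_integral do rewrite -cons_rV_affine -bE.
  over.
have mGa : measurable_fun setT (fun p => G (a *: cons_rV p + b)%R).
  apply: measurableT_comp mG _.
  exact: measurableT_comp (measurable_affine_rV a b) (@measurable_cons_rV R n).
rewrite ge0_integralZl_EFin//.
- by rewrite muleA -EFinM exprSr.
- by move=> v _; exact: integral_ge0.
- exact: (measurable_fun_fubini_tonelli_G (fun p => G (a *: cons_rV p + b)%R)).
Qed.

End lebesgue_rV_integration.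

(** * Moments of the one-dimensional standard normal density *)

Section standard_normal.
Context {R : realType}.
Local Notation leb := (@lebesgue_measure R).
Local Notation phi := (@normal_pdf R 0 1).
Local Notation c2pi := (Num.sqrt (2 * pi) : R).

Lemma sqrt2pi_gt0 : 0 < c2pi.
Proof. by rewrite sqrtr_gt0 mulr_gt0// pi_gt0. Qed.

Lemma std_normalE x : phi x = c2pi^-1 * expR (- (x ^+ 2 / 2)).
Proof.
rewrite normal_pdfE ?oner_eq0// /normal_peak /normal_fun subr0 expr1n mul1r.
by rewrite mulr_natl mulNr.
Qed.

Lemma std_normal_gt0 x : 0 < phi x.
Proof. by rewrite std_normalE mulr_gt0 ?expR_gt0// invr_gt0 sqrt2pi_gt0. Qed.

Lemma std_normal_le1 x : phi x <= 1.
Proof.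
rewrite std_normalE -[leRHS]mulr1 ler_pM// ?invr_ge0 ?sqrtr_ge0 ?expR_ge0//.
  rewrite invf_le1 ?sqrt2pi_gt0// -[leLHS]sqrtr1 ler_sqrt//.
    by have := @pi_ge2 R; lra.
  by rewrite mulr_ge0// pi_ge0.
by rewrite -[leRHS]expR0 ler_expR oppr_le0 divr_ge0// sqr_ge0.
Qed.

Lemma std_normalN x : phi (- x) = phi x.
Proof. by rewrite !std_normalE sqrrN. Qed.

Lemma is_derive_std_normal (x : R) : is_derive x (1 : R) phi (- x * phi x).
Proof.
have -> : phi = (fun x => c2pi^-1 * expR (- (x ^+ 2 / 2))).
  by apply/funext => y; exact: std_normalE.
apply: is_derive_eq.
rewrite !scaler0 add0r /GRing.scale/= mulr1.
set c := (Num.ExtraDef.sqrtr _)^-1; set e := expR _; by field.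
Qed.

(** The known limit is that of [gauss_fun], which is [expR (- x ^+ 2)]; hence the rescaling by
    [sqrt 2]. *)
Lemma cvg_std_normal : phi x @[x --> +oo] --> 0.
Proof.
have -> : phi = (fun x => c2pi^-1 * gauss_fun (x * (Num.sqrt 2)^-1)).
  apply/funext => y; rewrite std_normalE /gauss_fun exprMn exprVn sqr_sqrtr//.
rewrite -[X in _ --> X](mulr0 c2pi^-1); apply: cvgM; first exact: cvg_cst.
apply: (cvg_comp (fun x : R => x * (Num.sqrt 2)^-1) (@gauss_fun R)); last exact: cvg_gauss_fun.
by apply: gt0_cvgMly; [rewrite invr_gt0 sqrtr_gt0|exact: cvg_id].
Qed.

Lemma std_normal_tail (t : R) : (0 <= t) ->
  (\int[leb]_(x in `[t, +oo[) (x * phi x)%:E = (phi t)%:E)%E.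
Proof.
move=> t0; rewrite (@ge0_continuous_FTC2y _ _ (fun x => - phi x) t 0).
- by rewrite sub0e -EFinN opprK.
- by move=> x tx; apply: mulr_ge0; [exact: le_trans tx|exact: normal_pdf_ge0].
- apply: continuous_subspaceT => x; apply: cvgM; first exact: cvg_id.
  exact: continuous_normal_pdf.
- by rewrite -[X in _ --> X]oppr0; apply: cvgN; exact: cvg_std_normal.
- by move=> x _; apply: derivableN; case: (is_derive_std_normal x).
- by apply: cvgN; apply: cvg_at_right_filter; exact: continuous_normal_pdf.
- move=> x _; rewrite derive1E deriveN; last by case: (is_derive_std_normal x).
  by case: (is_derive_std_normal x) => _ ->; rewrite mulNr opprK.
Qed.

Lemma half_std_normal : (\int[leb]_(x in [set x | (0 <= x)%R]) (phi x)%:E = (2^-1)%:E)%E.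
Proof.
have := @ge0_symfun_integralT R phi (normal_pdf_ge0 0 1)
  (@continuous_normal_pdf R 0 1 (oner_neq0 R)).
rewrite integral_normal_pdf => /(_ (fun x => esym (std_normalN x))).
set I := (\int[_]_(_ in _) _)%E => h.
have : (I = (2^-1)%:E * (2%:E * I))%E by rewrite muleA -EFinM mulVf// mul1e.
by rewrite -h mule1.
Qed.

(** Integration by parts in the guise of Tonelli: for [x >= 0], [phi x * x ^+ 2] is the integral of
    [x * phi x] over [0 <= t <= x]; integrating in [x] first leaves the tail [phi t], and the half
    line carries mass 1/2. *)
Lemma std_normal_var : (\int[leb]_x (phi x * x ^+ 2)%:E = 1)%E.
Proof.
rewrite ge0_symfun_integralT; first last.
- by move=> x /=; rewrite std_normalN sqrrN.
- move=> x; apply: cvgM; first exact: continuous_normal_pdf.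
  exact: exprn_continuous.
- by move=> x; rewrite mulr_ge0 ?normal_pdf_ge0 ?sqr_ge0.
rewrite (_ : 1 = 2%:E * (2^-1)%:E)%E; last by rewrite -EFinM divff.
congr (_ * _)%E; rewrite -half_std_normal.
pose K (p : measurableTypeR R * measurableTypeR R) : \bar R :=
  if (0 <= (p.1 : R)) && ((p.1 : R) <= p.2) then ((p.2 : R) * phi p.2)%:E else 0%E.
have mK : measurable_fun setT K.
  apply: measurable_fun_ifT => //.
    apply: measurable_and; apply: measurable_fun_ler => //.
  apply/measurable_EFinP; apply: measurable_funM => //.
  by apply: measurableT_comp => //; exact: measurable_normal_pdf.
have K0 p : (0 <= K p)%E.
  rewrite /K; case: ifPn => // /andP[p0 pp].
  by rewrite lee_fin mulr_ge0 ?normal_pdf_ge0// (le_trans p0).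
transitivity (\int[leb]_x \int[leb]_t K (t, x))%E.
  rewrite [LHS]integral_mkcond; apply: eq_integral => x _.
  rewrite patchE; case: ifPn => [|x0].
    rewrite inE/= => x0.
    rewrite (_ : (fun t => _) = (cst (x * phi x)%:E) \_ `[0, x]); last first.
      apply/funext => t; rewrite patchE /K/=.
      case: ifPn => [t0x|/negP t0x]; first by rewrite mem_set.
      by rewrite memNset//= in_itv/=.
    rewrite -integral_mkcond integral_cst//= lebesgue_measure_itv/= lte_fin.
    case: ltrP => [x_gt0|x_le0].
      by rewrite -EFinD -EFinM subr0 expr2 mulrC mulrAC.
    by rewrite (_ : x = 0) ?expr0n ?mulr0 ?mule0//; apply/eqP; rewrite eq_le x0 x_le0.
  rewrite integral0_eq// => t _; rewrite /K; case: ifPn => //= /andP[t0 tx].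
  by case/negP: x0; rewrite inE/= (le_trans t0).
rewrite -(fubini_tonelli K)// [RHS]integral_mkcond; apply: eq_integral => t _.
rewrite patchE; case: ifPn => [|t0].
  rewrite inE/= => t0; rewrite -std_normal_tail// [RHS]integral_mkcond.
  apply: eq_integral => x _; rewrite patchE /K/= t0/=.
  case: ifPn => [tx|/negP tx]; first by rewrite mem_set//= in_itv/= tx.
  by rewrite memNset//= in_itv/= andbT.
apply: integral0_eq => x _; rewrite /K/=; case: ifPn => // /andP[t1 _].
by case/negP: t0; rewrite inE.
Qed.

(** The integral for [- a] has the same value by symmetry, and adding the two removes the cross term
    in [a * x], so only nonnegative integrands occur. *)
Lemma std_normal_moment2 (a : R) :
  (\int[leb]_x (phi x * (x + a) ^+ 2)%:E = (1 + a ^+ 2)%:E)%E.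
Proof.
have mphi : measurable_fun [set: R] phi := measurable_normal_pdf 0 1.
have m1 b : measurable_fun [set: R] (fun x => (phi x * (x + b) ^+ 2)%:E).
  apply/measurable_EFinP; apply: measurable_funM => //.
  by apply: measurable_funX; exact: measurable_funD.
have p0 b x : (0 <= (phi x * (x + b) ^+ 2)%:E)%E.
  by rewrite lee_fin mulr_ge0 ?normal_pdf_ge0 ?sqr_ge0.
set I := LHS.
have I2 : (I = \int[leb]_x (phi x * (x - a) ^+ 2)%:E)%E.
  rewrite /I (@ge0_integral_affine1 _ (- 1) 0)//.
  rewrite normrN1 mul1e; apply: eq_integral => x _.
  by rewrite addr0 mulN1r std_normalN -opprB sqrrN [a - x]addrC.
have : (I + I = 2%:E * (1 + a ^+ 2)%:E)%E.
  rewrite {1}I2 /I -ge0_integralD//; [|exact: m1|exact: m1].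
  transitivity (\int[leb]_x (2%:E * (phi x * x ^+ 2)%:E + (2 * a ^+ 2)%:E * (phi x)%:E))%E.
    by apply: eq_integral => x _; rewrite -!EFinM -!EFinD; congr _%:E; ring.
  rewrite ge0_integralD//; last 4 first.
  - by move=> x _; rewrite -EFinM lee_fin mulr_ge0// mulr_ge0 ?normal_pdf_ge0 ?sqr_ge0.
  - by apply/measurable_EFinP/measurable_funM => //; exact: measurable_funM.
  - by move=> x _; rewrite -EFinM lee_fin mulr_ge0 ?normal_pdf_ge0// mulr_ge0 ?sqr_ge0.
  - by apply/measurable_EFinP/measurable_funM.
  rewrite ge0_integralZl_EFin//; last 2 first.
  - by move=> x _; rewrite lee_fin mulr_ge0 ?normal_pdf_ge0 ?sqr_ge0.
  - by apply/measurable_EFinP/measurable_funM.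
  rewrite ge0_integralZl_EFin//; last 3 first.
  - by move=> x _; rewrite lee_fin normal_pdf_ge0.
  - exact/measurable_EFinP.
  - by rewrite mulr_ge0 ?sqr_ge0.
  rewrite std_normal_var integral_normal_pdf !mule1 -EFinD -EFinM; congr _%:E; ring.
case: (I) => [r| |] //.
by rewrite -EFinD -EFinM => -[] r2; congr _%:E; lra.
Qed.

End standard_normal.

(** * The standard Gaussian density in dimension [n] *)

Section std_gaussian.
Context {R : realType}.
Local Notation leb := (@lebesgue_measure R).
Local Notation phi := (@normal_pdf R 0 1).
Local Notation c2pi := (Num.sqrt (2 * pi) : R).

Definition sqnorm n (x : 'rV[R]_n) : R := \sum_(i < n) x ord0 i ^+ 2.

(** The product form lets inductions split off one coordinate; [gaussian_pdfE] relates it to the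
    matrix form [gaussian_pdf]. *)
Definition std_gaussian n (x : 'rV[R]_n) : R := \prod_(i < n) phi (x ord0 i).

Lemma sqnorm_ge0 n (x : 'rV[R]_n) : 0 <= sqnorm x.
Proof. by apply: sumr_ge0 => i _; exact: sqr_ge0. Qed.

Lemma sqnormZ n a (x : 'rV[R]_n) : sqnorm (a *: x) = a ^+ 2 * sqnorm x.
Proof. by rewrite /sqnorm mulr_sumr; apply: eq_bigr => i _; rewrite mxE exprMn. Qed.

Lemma sqnorm_cons n x (v : 'rV[R]_n) : sqnorm (cons_rV (x, v)) = x ^+ 2 + sqnorm v.
Proof.
rewrite /sqnorm big_ord_recl cons_rV0; congr (_ + _).
by apply: eq_bigr => i _; rewrite cons_rVS.
Qed.

Lemma std_gaussian_cons n x (v : 'rV[R]_n) :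
  std_gaussian (cons_rV (x, v)) = phi x * std_gaussian v.
Proof.
rewrite /std_gaussian big_ord_recl cons_rV0; congr (_ * _).
by apply: eq_bigr => i _; rewrite cons_rVS.
Qed.

Lemma std_gaussian_gt0 n (x : 'rV[R]_n) : 0 < std_gaussian x.
Proof. by apply: prodr_gt0 => i _; exact: std_normal_gt0. Qed.

Lemma std_gaussian_ge0 n (x : 'rV[R]_n) : 0 <= std_gaussian x.
Proof. exact: ltW (std_gaussian_gt0 x). Qed.

Lemma std_gaussian_le1 n (x : 'rV[R]_n) : std_gaussian x <= 1.
Proof.
by apply: prodr_ile1 => i _; rewrite normal_pdf_ge0 std_normal_le1.
Qed.

Lemma measurable_std_gaussian n : measurable_fun [set: 'rV[R]_n] (@std_gaussian n).
Proof.
apply: measurable_prod => i _; apply: measurableT_comp.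
  exact: measurable_normal_pdf.
exact: measurable_rV_coord.
Qed.

Lemma measurable_sqnorm n : measurable_fun [set: 'rV[R]_n] (@sqnorm n).
Proof.
by apply: measurable_sum => i; apply: measurable_funX; exact: measurable_rV_coord.
Qed.

Lemma std_gaussianE n (x : 'rV[R]_n) :
  std_gaussian x = (c2pi ^+ n)^-1 * expR (- (sqnorm x / 2)).
Proof.
rewrite /std_gaussian; under eq_bigr do rewrite std_normalE.
rewrite big_split/= prodr_const card_ord exprVn; congr (_ * _).
by rewrite -expR_sum sumrN mulr_suml.
Qed.

Lemma ln_std_gaussian n (x : 'rV[R]_n) :
  ln (std_gaussian x) = - (n%:R * ln c2pi) - sqnorm x / 2.
Proof.
rewrite std_gaussianE lnM ?posrE ?expR_gt0//; last first.
  by rewrite invr_gt0 exprn_gt0// sqrt2pi_gt0.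
rewrite expRK lnV ?posrE ?exprn_gt0 ?sqrt2pi_gt0//.
by rewrite lnXn ?sqrt2pi_gt0// -[in LHS](mulr_natl (ln _)).
Qed.

Lemma integral_std_gaussian n :
  (\int[lebesgue_rV R n]_x (std_gaussian x)%:E = 1)%E.
Proof.
elim: n => [|n IH]; first by rewrite integral_rV0 /std_gaussian big_ord0.
rewrite ge0_integral_cons; last 2 first.
- apply/measurable_EFinP; exact: measurable_std_gaussian.
- by move=> x; rewrite lee_fin std_gaussian_ge0.
rewrite -IH; apply: eq_integral => v _.
under eq_integral do rewrite std_gaussian_cons EFinM muleC.
rewrite ge0_integralZl_EFin//; last 3 first.
- by move=> x _; rewrite lee_fin normal_pdf_ge0.
- by apply/measurable_EFinP; exact: measurable_normal_pdf.
- exact: std_gaussian_ge0.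
by rewrite integral_normal_pdf mule1.
Qed.

Lemma std_gaussian_moment2 n (a : 'rV[R]_n) :
  (\int[lebesgue_rV R n]_x (std_gaussian x * sqnorm (x + a))%:E =
   (n%:R + sqnorm a)%:E)%E.
Proof.
elim: n => [|n IH] in a *.
  by rewrite integral_rV0 /std_gaussian /sqnorm !big_ord0 mulr0 addr0.
have mS m (b : 'rV[R]_m) : measurable_fun [set: 'rV[R]_m] (fun x => sqnorm (x + b)).
  have := measurable_affine_rV 1 b; under eq_fun do rewrite scale1r.
  exact: measurableT_comp (@measurable_sqnorm m).
have mgS m (b : 'rV[R]_m) :
    measurable_fun [set: 'rV[R]_m] (fun x => (std_gaussian x * sqnorm (x + b))%:E).
  apply/measurable_EFinP/measurable_funM; last exact: mS.
  exact: measurable_std_gaussian.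
rewrite ge0_integral_cons; last 2 first.
- exact: mgS.
- by move=> x; rewrite lee_fin mulr_ge0 ?std_gaussian_ge0 ?sqnorm_ge0.
rewrite -[a]uncons_rVK; set a0 : R := (uncons_rV a).1; set a' := (uncons_rV a).2.
transitivity (\int[lebesgue_rV R n]_v ((1 + a0 ^+ 2)%:E * (std_gaussian v)%:E
    + (std_gaussian v * sqnorm (v + a'))%:E))%E.
  apply: eq_integral => v _.
  have aE x : cons_rV (x, v) + cons_rV (a0, a') = cons_rV (x + a0, v + a').
    by have := cons_rV_affine 1 x a0 v a'; rewrite !scale1r mul1r.
  transitivity (\int[leb]_x ((std_gaussian v)%:E * (phi x * (x + a0) ^+ 2)%:E
     + (std_gaussian v * sqnorm (v + a'))%:E * (phi x)%:E))%E.
    apply: eq_integral => x _; rewrite -[uncons_rV a]/(a0, a') aE.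
    rewrite std_gaussian_cons sqnorm_cons.
    by rewrite -!EFinM -EFinD; congr _%:E; ring.
  have mphi : measurable_fun [set: R] phi := measurable_normal_pdf 0 1.
  have m1 : measurable_fun [set: R] (fun x : R => (phi x * (x + a0) ^+ 2)%:E).
    apply/measurable_EFinP/measurable_funM => //.
    by apply: measurable_funX; exact: measurable_funD.
  rewrite ge0_integralD//; last 4 first.
  - move=> x _; rewrite -EFinM lee_fin mulr_ge0 ?std_gaussian_ge0// mulr_ge0//.
      exact: normal_pdf_ge0.
    exact: sqr_ge0.
  - by apply: emeasurable_funM => //; exact: m1.
  - move=> x _; rewrite -EFinM lee_fin mulr_ge0 ?normal_pdf_ge0//.
    by rewrite mulr_ge0 ?std_gaussian_ge0 ?sqnorm_ge0.
  - by apply: emeasurable_funM => //; exact/measurable_EFinP.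
  rewrite ge0_integralZl_EFin//; last 2 first.
  - by move=> x _; rewrite lee_fin mulr_ge0 ?normal_pdf_ge0 ?sqr_ge0.
  - exact: std_gaussian_ge0.
  rewrite ge0_integralZl_EFin//; last 3 first.
  - by move=> x _; rewrite lee_fin normal_pdf_ge0.
  - exact/measurable_EFinP.
  - by rewrite mulr_ge0 ?std_gaussian_ge0 ?sqnorm_ge0.
  by rewrite std_normal_moment2 integral_normal_pdf mule1 muleC.
rewrite ge0_integralD//; last 4 first.
- move=> v _; rewrite -EFinM lee_fin mulr_ge0 ?std_gaussian_ge0//.
  by rewrite addr_ge0 ?sqr_ge0.
- apply: emeasurable_funM => //; apply/measurable_EFinP.
  exact: measurable_std_gaussian.
- by move=> v _; rewrite lee_fin mulr_ge0 ?std_gaussian_ge0 ?sqnorm_ge0.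
- exact: mgS.
rewrite ge0_integralZl_EFin//; last 3 first.
- by move=> x _; rewrite lee_fin std_gaussian_ge0.
- apply/measurable_EFinP; exact: measurable_std_gaussian.
- by rewrite addr_ge0 ?sqr_ge0.
rewrite integral_std_gaussian mule1 IH -EFinD; congr _%:E.
by rewrite -[uncons_rV a]/(a0, a') sqnorm_cons -natr1; ring.
Qed.

Lemma gaussian_pdfE n (r : R) (x : 'rV[R]_n) : 0 < r ->
  gaussian_pdf 0 (r ^+ 2)%:M x = (r ^+ n)^-1 * std_gaussian (r^-1 *: x).
Proof.
move=> r0; rewrite /gaussian_pdf subr0 det_scalar invmx_scalar.
rewrite mul_mx_scalar -scalemxAl mxE std_gaussianE sqnormZ mulrA.
congr (_ * expR _).
  rewrite -exprMn -invfM; congr _^-1.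
  rewrite -[RHS]ger0_norm ?mulr_ge0 ?exprn_ge0 ?sqrtr_ge0 ?(ltW r0)//.
  rewrite -sqrtr_sqr; congr Num.sqrt.
  rewrite [RHS]exprMn (exprAC _ n 2) [in RHS](exprAC _ n 2) sqr_sqrtr//.
    by rewrite exprMn mulrC.
  by rewrite mulr_ge0// pi_ge0.
rewrite mulNr exprVn; congr (- (_ * _ / 2)).
by rewrite mxE; apply: eq_bigr => i _; rewrite mxE expr2.
Qed.

End std_gaussian.

(** * Integral of the derivative of a bounded monotone function *)

Section monotone_derivative.
Context {R : realType}.
Local Notation leb := (@lebesgue_measure R).

Lemma is_derive_cvg_seq (g : R -> R) (x l : R) (s : R^nat) :
  (forall n, s n != 0) -> s n @[n --> \oo] --> 0 -> is_derive x (1 : R) g l ->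
  (s n)^-1 * (g (x + s n) - g x) @[n --> \oo] --> l.
Proof.
move=> s0 cs [dg <-].
have /cvgr_dnbhsP/(_ s) := dg; move=> /(_ (conj s0 cs)).
apply: cvg_trans; apply: near_eq_cvg; near=> n => /=.
by rewrite [(s n)%:A]mulr1 [s n + x]addrC.
Unshelve. all: by end_near. Qed.

(** After translation the integrals over the common part cancel; what remains is at most the
    integral of [g <= 1] over [[b, b + e[]. *)
Lemma integral_shift_sub_le (g : R -> R) (a b e : R) : a <= b -> 0 <= e ->
  {homo g : x y / x <= y} -> (forall x, 0 <= g x <= 1) ->
  (\int[leb]_(x in `[a, b[) (g (x + e) - g x)%:E <= e%:E)%E.
Proof.
move=> ab e0 ng g01.
have mg : measurable_fun [set: R] g by exact: nondecreasing_measurable.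
have mge : measurable_fun [set: R] (fun x => g (x + e)).
  by apply: measurableT_comp => //; exact: measurable_funD.
have g0 x : (0 <= (g x)%:E)%E by rewrite lee_fin; case/andP: (g01 x).
have Ige : (\int[leb]_(x in `[a, b[) (g x)%:E < +oo)%E.
  apply: (@le_lt_trans _ _ (\int[leb]_(x in `[a, b[) (cst 1 x))%E).
    apply: ge0_le_integral => //.
    - exact/measurable_EFinP/measurable_funTS.
    - by move=> x _; rewrite lee_fin; case/andP: (g01 x).
  rewrite integral_cst//= mul1e lebesgue_measure_itv/=.
  by case: ifP => // _; rewrite -EFinD ltry.
have fing : (\int[leb]_(x in `[a, b[) (g x)%:E)%E \is a fin_num.
  by rewrite ge0_fin_numE//; exact: integral_ge0.
rewrite -(leeD2rE _ _ fing) -ge0_integralD//; last 3 first.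
- by move=> x _; rewrite lee_fin subr_ge0 ng// lerDl.
- by apply/measurable_EFinP/measurable_funTS/measurable_funB.
- exact/measurable_EFinP/measurable_funTS.
under eq_integral do rewrite -EFinD subrK.
have -> : (\int[leb]_(x in `[a, b[) (g (x + e))%:E =
    \int[leb]_(x in `[(a + e)%R, (b + e)%R[) (g x)%:E)%E.
  rewrite integral_mkcond [RHS]integral_mkcond.
  rewrite [RHS](@ge0_integral_affine1 _ 1 e)//; last 2 first.
  - by apply/(measurable_restrictT _ _).1 => //; exact/measurable_EFinP/measurable_funTS.
  - by apply: erestrict_ge0.
  rewrite normr1 mul1e; apply: eq_integral => x _.
  by rewrite mul1r !patchE !mem_setE !in_itv/= lerD2r ltrD2r.
apply: (@le_trans _ _ (\int[leb]_(x in `[a, (b + e)%R[) (g x)%:E)%E).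
  apply: ge0_subset_integral => //.
  - exact/measurable_EFinP/measurable_funTS.
  - by apply: subset_itvr; rewrite bnd_simp lerDl.
rewrite (_ : `[a, (b + e)%R[%classic = `[a, b[ `|` `[b, (b + e)%R[); last first.
  by rewrite -itv_bndbnd_setU// bnd_simp// lerDl.
rewrite ge0_integral_setU//=; last 2 first.
- exact/measurable_EFinP/measurable_funTS.
- apply/disj_setPS => x [] /=; rewrite !in_itv/= => /andP[_ xb] /andP[bx _].
  by move: xb; rewrite ltNge bx.
rewrite addeC leeD2rE//.
apply: (@le_trans _ _ (\int[leb]_(x in `[b, (b + e)%R[) (cst 1 x))%E).
  apply: ge0_le_integral => //.
  - exact/measurable_EFinP/measurable_funTS.
  - by move=> x _; rewrite lee_fin; case/andP: (g01 x).
rewrite integral_cst//= mul1e lebesgue_measure_itv/=.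
case: ifP => // _; rewrite -?EFinD lee_fin//; lra.
Qed.

(* Fatou's lemma applied to the difference quotients of step [1 / n.+1]. *)
Lemma integral_derive_le1 (g k : R -> R) (D : set R) : measurable D ->
  {homo g : x y / x <= y} -> (forall x, 0 <= g x <= 1) ->
  measurable_fun D k -> (forall x, D x -> 0 <= k x) ->
  {ae leb, forall x, D x -> is_derive x (1 : R) g (k x)} ->
  (\int[leb]_(x in D) (k x)%:E <= 1)%E.
Proof.
move=> mD ng g01 mk k0 dg.
pose q n x : R := n.+1%:R * (g (x + n.+1%:R^-1) - g x).
(* The shift bound concerns bounded intervals, so the quotient is cut off to [[- n, n[]; every point
   lies inside from some [n] on. *)
pose f n (x : measurableTypeR R) : \bar R := ((EFin \o q n) \_ `[- n%:R, n%:R[) x.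
have mg : measurable_fun [set: R] g by exact: nondecreasing_measurable.
have mge e : measurable_fun [set: R] (fun x => g (x + e)).
  by apply: measurableT_comp => //; exact: measurable_funD.
have mq n : measurable_fun [set: R] (EFin \o q n).
  by apply/measurable_EFinP/measurable_funM => //; exact: measurable_funB.
have q0 n x : 0 <= q n x.
  by rewrite mulr_ge0// subr_ge0 ng// lerDl.
have mfT n : measurable_fun [set: measurableTypeR R] (f n).
  by apply/(measurable_restrictT _ _).1 => //; exact: measurable_funTS (mq n).
have mf n : measurable_fun D (f n) by exact: measurable_funTS (mfT n).
have f0 n x : D x -> (0 <= f n x)%E.
  by move=> _; apply: erestrict_ge0 => y _; rewrite lee_fin.
have fle1 n : (\int[leb]_(x in D) f n x <= 1)%E.
  apply: (@le_trans _ _ (\int[leb]_(x in setT) f n x)%E).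
    apply: ge0_subset_integral => //.
    by move=> x _; apply: erestrict_ge0 => y _; rewrite lee_fin.
  rewrite /f -integral_mkcond.
  under eq_integral do rewrite /= /q EFinM.
  rewrite ge0_integralZl_EFin//; last 2 first.
  - by move=> x _; rewrite lee_fin subr_ge0 ng// lerDl.
  - apply/measurable_EFinP/measurable_funTS/measurable_funB => //; exact: mge.
  rewrite -[leRHS](_ : n.+1%:R%:E * (n.+1%:R^-1)%:E = 1)%E; last first.
    by rewrite -EFinM divff.
  rewrite lee_pmul2l// integral_shift_sub_le//.
  by rewrite (@le_trans _ _ 0)// oppr_le0.
apply: (@le_trans _ _ (\int[leb]_(x in D) limn_einf (f^~ x))%E); last first.
  apply: le_trans (fatou leb mD mf f0) _.
  rewrite limn_einf_lim; apply: lime_le; first exact: is_cvg_einfs.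
  apply: nearW => n; apply: le_trans (fle1 n).
  by apply: ereal_inf_lbound; exists n => /=.
apply: ae_ge0_le_integral => //.
- exact/measurable_EFinP.
- by move=> x Dx; rewrite limn_einf_lim; apply: lime_ge; [exact: is_cvg_einfs|];
    apply: nearW => n; apply: le_ereal_inf_tmp => _ [m /= nm <-]; exact: f0.
- rewrite (_ : (fun x => _) = (fun x => - limn_esup (fun n => - f n x))%E); last first.
    apply/funext => x; rewrite -limn_einfN; congr limn_einf.
    by apply/funext => n /=; rewrite oppeK.
  apply: measurableT_comp => //; apply: measurable_fun_limn_esup => n.
  by apply: measurableT_comp => //; exact: mf.
apply: filterS dg; first exact: (ae_filter_ringOfSetsType leb).
move=> x /= dg Dx; have {}dg := dg Dx.
have s0 n : (n.+1%:R : R)^-1 != 0 by rewrite invr_neq0.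
have := is_derive_cvg_seq s0 (@cvg_harmonic R) dg.
move=> cq; have cf : f n x @[n --> \oo] --> (k x)%:E.
  have : (q n x)%:E @[n --> \oo] --> (k x)%:E.
    apply: cvg_EFin; first by near=> n.
    by move: cq; under eq_fun do rewrite invrK.
  apply: cvg_trans; apply: near_eq_cvg; near=> n.
  rewrite /f patchE mem_set//= in_itv/=.
  have : `|x| < n%:R.
    by near: n; exact: nbhs_infty_gtr.
  by rewrite ltr_norml => /andP[/ltW -> ->].
by case: (cvg_limn_einf_sup cf) => ->.
Unshelve. all: by end_near.
Qed.

End monotone_derivative.

(** * The distribution function of a density on the line *)

Section cdf_of_density.
Context {R : realType}.
Local Notation leb := (@lebesgue_measure R).
Variable h : R -> R.
Hypothesis mh : measurable_fun [set: R] h.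
Hypothesis h0 : forall x, 0 <= h x.
Hypothesis h1 : (\int[leb]_x (h x)%:E = 1)%E.

Definition dcdf (x : R) : R := (\int[leb]_(t in `]-oo, x]) h t)%R.

Let mEh : measurable_fun [set: R] (EFin \o h).
Proof. exact/measurable_EFinP. Qed.

Lemma density_integrable : leb.-integrable [set: R] (EFin \o h).
Proof.
apply/integrableP; split => //; under eq_integral do rewrite /= ger0_norm//.
by rewrite h1 ltry.
Qed.

Let le1 (A : set R) : measurable A -> (\int[leb]_(t in A) (h t)%:E <= 1)%E.
Proof.
move=> mA; rewrite -h1; apply: ge0_subset_integral => //.
by move=> x _; rewrite lee_fin.
Qed.

Lemma dcdfE x : (dcdf x)%:E = (\int[leb]_(t in `]-oo, x]) (h t)%:E)%E.
Proof.
rewrite /dcdf /Rintegral fineK// ge0_fin_numE; last first.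
  by apply: integral_ge0 => t _; rewrite lee_fin.
by apply: le_lt_trans (le1 _) _; rewrite ?ltry.
Qed.

Lemma dcdf_itv01 x : 0 <= dcdf x <= 1.
Proof.
rewrite -!lee_fin dcdfE le1// andbT.
by apply: integral_ge0 => t _; rewrite lee_fin.
Qed.

Lemma dcdf_homo : {homo dcdf : x y / x <= y}.
Proof.
move=> x y xy; rewrite -lee_fin !dcdfE; apply: ge0_subset_integral => //.
- exact: measurable_funTS.
- by move=> t _; rewrite lee_fin.
- exact: subset_itvl.
Qed.

(** For a merely integrable density this rests on Lebesgue differentiation, and it is why the
    Jacobians below are controlled only almost everywhere. *)
Lemma ae_is_derive_dcdf : {ae leb, forall x, is_derive x (1 : R) dcdf (h x)}.
Proof.
have locint : locally_integrable [set: R] h.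
  by apply: open_integrable_locally; [exact: openT|exact: density_integrable].
have inty y : leb.-integrable `]-oo, y] (EFin \o h).
  exact: integrableS density_integrable.
have := FTC1Ny inty locint.
apply: filterS; first exact: (ae_filter_ringOfSetsType leb).
by move=> x [dx dxE]; apply: DeriveDef => //; rewrite -derive1E.
Qed.

Lemma is_derive_dcdf x : {for x, continuous h} -> is_derive x (1 : R) dcdf (h x).
Proof.
move=> ch; have [] := @continuous_FTC1 _ h -oo%O x (x + 1) _ _ _ ch.
- by rewrite ltrDl.
- exact: integrableS density_integrable.
- by rewrite ltNyr.
by move=> dx dxE; apply: DeriveDef => //; rewrite -derive1E.
Qed.

(* [dcdf] is extremal wherever it equals 0 or 1, so that its derivative
   vanishes there. *)
Lemma ae_dcdf_oo01 : {ae leb, forall x, 0 < h x -> 0 < dcdf x < 1}.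
Proof.
apply: filterS ae_is_derive_dcdf; first exact: (ae_filter_ringOfSetsType leb).
move=> x dx hx; have /andP[F0 F1] := dcdf_itv01 x.
rewrite !lt_neqAle F0 F1 !andbT; apply/andP; split; apply/negP => /eqP Fx.
  have s0 n : - (n.+1%:R : R)^-1 != 0 by rewrite oppr_eq0 invr_neq0.
  have cs : - (n.+1%:R : R)^-1 @[n --> \oo] --> 0.
    by rewrite -[X in _ --> X]oppr0; apply: cvgN; exact: cvg_harmonic.
  have := is_derive_cvg_seq s0 cs dx; under eq_fun => n.
    have -> : dcdf (x + - n.+1%:R^-1) - dcdf x = 0.
      apply/eqP; rewrite subr_eq0 eq_le dcdf_homo ?gerBl//.
      by rewrite -[leLHS]Fx; case/andP: (dcdf_itv01 (x - n.+1%:R^-1)).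
    rewrite mulr0; over.
  move/cvg_lim => /(_ (@Rhausdorff R)); rewrite lim_cst//.
  by move=> h00; move: hx; rewrite -h00 ltxx.
have s0 n : (n.+1%:R : R)^-1 != 0 by rewrite invr_neq0.
have := is_derive_cvg_seq s0 (@cvg_harmonic R) dx; under eq_fun => n.
  have -> : dcdf (x + n.+1%:R^-1) - dcdf x = 0.
    apply/eqP; rewrite subr_eq0 eq_le [X in _ && X]dcdf_homo ?lerDl// andbT.
    by rewrite Fx; case/andP: (dcdf_itv01 (x + n.+1%:R^-1)).
  rewrite mulr0; over.
move/cvg_lim => /(_ (@Rhausdorff R)); rewrite lim_cst//.
by move=> h00; move: hx; rewrite -h00 ltxx.
Qed.

End cdf_of_density.

(** * The standard normal distribution function and its inverse *)

Section probit.
Context {R : realType}.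
Local Notation leb := (@lebesgue_measure R).
Local Notation phi := (@normal_pdf R 0 1).
Local Notation Phi := (dcdf phi).

Let mphi : measurable_fun [set: R] phi := measurable_normal_pdf 0 1.
Let phi0 : forall x, 0 <= phi x := normal_pdf_ge0 0 1.
Let phi1 : (\int[leb]_x (phi x)%:E = 1)%E := integral_normal_pdf 0 1.

Lemma is_derive_Phi x : is_derive x (1 : R) Phi (phi x).
Proof.
by apply: is_derive_dcdf => //; apply: continuous_normal_pdf; exact: oner_neq0.
Qed.

Lemma continuous_Phi : continuous Phi.
Proof.
move=> x; apply: differentiable_continuous; apply/derivable1_diffP.
by case: (is_derive_Phi x).
Qed.

Lemma Phi_lt : {homo Phi : x y / x < y}.
Proof.
move=> x y xy; apply: (@gtr0_derive1_lt_cc _ Phi x y) => //.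
- by move=> t _; case: (is_derive_Phi t).
- move=> t _; rewrite derive1E; case: (is_derive_Phi t) => _ ->.
  exact: std_normal_gt0.
- by apply: continuous_subspaceT => t; exact: continuous_Phi.
- by rewrite in_itv/= lexx ltW.
- by rewrite in_itv/= lexx ltW.
Qed.

(** Seen as a random variable under [normal_prob 0 1], this identity has [Phi] as its [cdf], from
    which the limits of [Phi] at both infinities follow. *)
Let idTR : measurableTypeR R -> R := idfun.

#[local] HB.instance Definition _ :=
  @isMeasurableFun.Build _ _ _ _ idTR (@measurable_id _ _ setT).

Let PhiE : Phi = fine \o cdf (idTR : {RV (normal_prob 0 1 : probability _ R) >-> R}).
Proof. by apply/funext => t. Qed.

Lemma cvg_PhiNy : Phi t @[t --> -oo] --> (0 : R).
Proof. by rewrite PhiE; apply: fine_cvg; exact: cvg_cdfNy0. Qed.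

Lemma cvg_Phiy : Phi t @[t --> +oo] --> (1 : R).
Proof. by rewrite PhiE; apply: fine_cvg; exact: cvg_cdfy1. Qed.

Lemma Phi_surj (y : R) : 0 < y < 1 -> exists t, Phi t = y.
Proof.
move=> /andP[y0 y1].
have [a Pa] : exists a, Phi a < y.
  near -oo_R => a; exists a; near: a; exact: (cvgr_lt _ cvg_PhiNy).
have [b Pb] : exists b, y < Phi b.
  near +oo_R => b; exists b; near: b; exact: (cvgr_gt _ cvg_Phiy).
have ab : a <= b.
  rewrite leNgt; apply/negP => /Phi_lt; apply/negP; rewrite -leNgt.
  exact: ltW (lt_trans Pa Pb).
have [||c _ <-] := @IVT _ Phi a b y ab; last by exists c.
  by apply: continuous_subspaceT => t; exact: continuous_Phi.
by rewrite ge_min (ltW Pa)/= le_max (ltW Pb) orbT.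
Unshelve. all: by end_near. Qed.

(** The quantile function of the standard normal law, with default value 0 outside []0, 1[], where
    [Phi] has no preimage. *)
Definition probit (y : R) : R := xget 0 [set t | Phi t = y].

Lemma PhiK : cancel Phi probit.
Proof.
move=> t; rewrite /probit; case: xgetP => [s _ /= st|/(_ t)//].
by apply/eqP; case: (ltgtP s t) st => // /Phi_lt + st; rewrite st ltxx.
by move=> /(_ erefl).
Qed.

Lemma probitK (y : R) : 0 < y < 1 -> Phi (probit y) = y.
Proof.
by move=> /Phi_surj[t <-]; rewrite PhiK.
Qed.

Lemma is_derive_probit (y : R) : 0 < y < 1 ->
  is_derive y (1 : R) probit (phi (probit y))^-1.
Proof.
move=> /Phi_surj[t <-]; rewrite PhiK.
apply: (is_derive_inverse (f := Phi)).
- by near=> x; exact: PhiK.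
- by near=> x; exact: continuous_Phi.
- exact: is_derive_Phi.
- by rewrite gt_eqF// std_normal_gt0.
Unshelve. all: by end_near. Qed.

Lemma measurable_probit : measurable_fun (`]0, 1[ : set R) probit.
Proof.
apply: open_continuous_measurable_fun; first exact: interval_open.
move=> y; rewrite inE/= in_itv/= => y01.
apply: differentiable_continuous; apply/derivable1_diffP.
by case: (is_derive_probit y01).
Qed.

End probit.

(** * The one-dimensional transport kernel has mass at most 1 *)

Section transport_kernel.
Context {R : realType}.
Local Notation leb := (@lebesgue_measure R).
Local Notation phi := (@normal_pdf R 0 1).
Local Notation Phi := (dcdf phi).

Let mphi : measurable_fun [set: R] phi := measurable_normal_pdf 0 1.
Let phi0 : forall x, 0 <= phi x := normal_pdf_ge0 0 1.
Let phi1 : (\int[leb]_x (phi x)%:E = 1)%E := integral_normal_pdf 0 1.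

Lemma measurable_inv_ge0 d (T : measurableType d) (f : T -> R) :
  (forall x, 0 <= f x) -> measurable_fun [set: T] f ->
  measurable_fun [set: T] (fun x => (f x)^-1).
Proof.
move=> f0 mf; under eq_fun do rewrite -powR_inv1//.
exact: measurableT_comp (measurable_powR (-1)) mf.
Qed.

Lemma Phi_le : {homo Phi : x y / x <= y}.
Proof. exact: dcdf_homo. Qed.

Lemma Phi_oo01 t : 0 < Phi t < 1.
Proof.
have /andP[P0 _] := dcdf_itv01 mphi phi0 phi1 (t - 1).
have /andP[_ P1] := dcdf_itv01 mphi phi0 phi1 (t + 1).
apply/andP; split; [apply: le_lt_trans P0 _|apply: lt_le_trans P1];
  by apply: Phi_lt; rewrite ?gtrBl ?ltrDl.
Qed.

Lemma probit_out (y : R) : ~~ (0 < y < 1) -> probit y = 0.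
Proof.
move=> y01; rewrite /probit; case: xgetP => // t _ /= ty.
by move: y01; rewrite -ty Phi_oo01.
Qed.

Lemma measurable_probitT : measurable_fun [set: R] (@probit R).
Proof.
rewrite (_ : @probit R = fun y => if (0 < y) && (y < 1) then probit y else 0); last first.
  by apply/funext => y; case: ifPn => // /probit_out.
apply: measurable_fun_if => //.
  by apply: measurable_and; apply: measurable_fun_ltr.
rewrite setTI; apply: measurable_funS measurable_probit => //.
Qed.

Lemma probit_le (x y : R) : 0 < x -> y < 1 -> x <= y -> probit x <= probit y.
Proof.
move=> x0 y1 xy; rewrite leNgt; apply/negP => /Phi_lt.
rewrite !probitK ?x0 ?y1 ?(lt_le_trans x0 xy) ?(le_lt_trans xy y1)//.
by rewrite ltNge xy.
Qed.

(* With y = F x the value of a distribution function F and z = F' x its density,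
   [kernel_jac a b y z] is the derivative at x of [a x + b (probit (F x))]. *)
Definition kernel_jac (a b y z : R) : R :=
  if (0 < y) && (y < 1) then a + b * (z / phi (probit y)) else 0.

Lemma kernel_jac_ge0 a b y z : 0 <= a -> 0 <= b -> 0 <= z -> 0 <= kernel_jac a b y z.
Proof.
move=> a0 b0 z0; rewrite /kernel_jac; case: ifP => // _.
by rewrite addr_ge0// mulr_ge0// divr_ge0.
Qed.

Lemma measurable_kernel_jac d (T : measurableType d) (a b : R) (F h : T -> R) :
  measurable_fun [set: T] F -> measurable_fun [set: T] h ->
  measurable_fun [set: T] (fun x => kernel_jac a b (F x) (h x)).
Proof.
move=> mF mh; apply: measurable_fun_ifT => //.
  by apply: measurable_and; apply: measurable_fun_ltr.
apply: measurable_funD => //; apply: measurable_funM => //.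
apply: measurable_funM => //; apply: measurable_inv_ge0 => //.
apply: measurableT_comp => //; apply: measurableT_comp => //.
exact: measurable_probitT.
Qed.

Variable h : R -> R.
Hypothesis mh : measurable_fun [set: R] h.
Hypothesis h0 : forall x, 0 <= h x.
Hypothesis h1 : (\int[leb]_x (h x)%:E = 1)%E.
Local Notation F := (dcdf h).

(** Where [0 < F x < 1] the integrand is almost everywhere the derivative of
    [Phi (a * (x - w) + b * probit (F x))], nondecreasing with values in [0, 1]; the sign inside
    [phi] is reversed because [phi] is even. *)
Lemma integral_kernel_le1 (a b w : R) : 0 <= a -> 0 <= b ->
  (\int[leb]_x (phi (a * (w - x) - b * probit (F x)) *
     kernel_jac a b (F x) (h x))%:E <= 1)%E.
Proof.
move=> a0 b0.
pose m x : R := a * (x - w) + b * probit (F x).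
pose D : set R := [set x | (0 < F x) && (F x < 1)].
have mF : measurable_fun [set: R] F.
  by apply: nondecreasing_measurable => //; exact: dcdf_homo.
have mD : measurable D.
  rewrite (_ : D = F @^-1` `]0, 1[); last first.
    by apply/seteqP; split => x /=; rewrite in_itv.
  by rewrite -[X in measurable X]setTI; exact: mF.
pose k x : R := phi (m x) * (a + b * (h x / phi (probit (F x)))).
(* Where [F x] is 0 or 1 the default value of [probit] could break monotonicity, so [Phi \o m] is
   continued there by 0 and 1. *)
pose g x : R := if F x <= 0 then 0 else if 1 <= F x then 1 else Phi (m x).
rewrite [leLHS](_ : _ = \int[leb]_(x in D) (k x)%:E)%E; last first.
  rewrite [RHS]integral_mkcond; apply: eq_integral => x _.
  rewrite patchE /kernel_jac; case: ifPn => FD.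
    rewrite mem_set//= /k -std_normalN; congr (phi _ * _)%:E.
    by rewrite /m; ring.
  by rewrite memNset ?mulr0//=; exact/negP.
have g01 x : 0 <= g x <= 1.
  rewrite /g; case: ifP => _; first by rewrite lexx ler01.
  by case: ifP => _; [rewrite lexx ler01|exact: dcdf_itv01].
apply: (integral_derive_le1 (g := g) mD).
- move=> x y xy; have Fxy := dcdf_homo mh h0 h1 xy.
  rewrite {1}/g; case: ifPn => [_|]; first by case/andP: (g01 y).
  rewrite -ltNge => Fx0.
  have Fy0 : (F y <= 0) = false by apply/negbTE; rewrite -ltNge (lt_le_trans Fx0).
  case: ifPn => [Fx1|]; first by rewrite /g Fy0 (le_trans Fx1 Fxy).
  rewrite -ltNge => Fx1; rewrite /g Fy0.
  case: ifPn => [_|]; first by case/andP: (dcdf_itv01 mphi phi0 phi1 (m x)).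
  rewrite -ltNge => Fy1; apply: Phi_le.
  by rewrite lerD// ler_wpM2l// ?lerB// probit_le.
- exact: g01.
- apply: measurable_funTS; apply: measurable_funM.
    apply: measurableT_comp => //; apply: measurable_funD.
      by apply: measurable_funM => //; exact: measurable_funB.
    apply: measurable_funM => //; apply: measurableT_comp => //.
    exact: measurable_probitT.
  apply: measurable_funD => //; apply: measurable_funM => //.
  apply: measurable_funM => //; apply: measurable_inv_ge0 => //.
  apply: measurableT_comp => //; apply: measurableT_comp => //.
  exact: measurable_probitT.
- by move=> x _; rewrite mulr_ge0// addr_ge0// mulr_ge0// divr_ge0.
have := ae_is_derive_dcdf mh h0 h1.
apply: filterS; first exact: (ae_filter_ringOfSetsType leb).
move=> x dF /andP[Fx0 Fx1].
have cF : {for x, continuous F}.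
  by apply: differentiable_continuous; apply/derivable1_diffP; case: dF.
(* Continuity of [F] at [x] keeps [0 < F < 1] nearby, where [g] is [Phi \o m]. *)
apply: (@near_eq_is_derive _ _ _ (Phi \o m)).
  near=> y; rewrite /g /= ifF; last first.
    by apply/negbTE; rewrite -ltNge; near: y; exact: (cvgr_gt _ cF).
  rewrite ifF//; apply/negbTE; rewrite -ltNge; near: y; exact: (cvgr_lt _ cF).
have dP : is_derive (F x) (1 : R) (@probit R) (phi (probit (F x)))^-1.
  by apply: is_derive_probit; rewrite Fx0.
have dPF : is_derive x (1 : R) (@probit R \o F) ((phi (probit (F x)))^-1 * h x).
  exact: is_derive1_comp.
have dm : is_derive x (1 : R) m (a + b * (h x / phi (probit (F x)))).
  rewrite (_ : m = (fun x : R => a * (x - w)) + (fun y => b * (@probit R \o F) y)); last first.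
    by apply/funext.
  apply: is_derive_eq.
  by rewrite subr0 /GRing.scale/= mulr1 [h x / _]mulrC.
have dPh := is_derive_Phi (m x).
have := @is_derive1_comp _ Phi m x _ _ dPh dm.
exact.
Unshelve. all: by end_near. Qed.

End transport_kernel.

(** * Null sets and measurability through one-dimensional slices *)

Section knothe.
Context {R : realType}.
Local Notation leb := (@lebesgue_measure R).
Local Notation phi := (@normal_pdf R 0 1).

Lemma lebesgue_rV_null n (B : set 'rV[R]_n.+1) : measurable B ->
  {ae lebesgue_rV R n, forall v, {ae leb, forall x, ~ B (cons_rV (x, v))}} ->
  lebesgue_rV R n.+1 B = 0%E.
Proof.
move=> mB nB.
have mI : measurable_fun [set: 'rV[R]_n.+1] (fun x => (\1_B x)%:E : \bar R).
  by apply/measurable_EFinP; exact: measurable_indic.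
have mIc : measurable_fun setT (fun p => (\1_B (@cons_rV R n p))%:E : \bar R).
  exact: measurableT_comp mI (@measurable_cons_rV R n).
transitivity (\int[lebesgue_rV R n.+1]_x (\1_B x)%:E)%E.
  by rewrite integral_indic// setIT.
rewrite ge0_integral_cons//.
transitivity (\int[lebesgue_rV R n]_v (cst 0 v))%E; last exact: integral0.
apply: ge0_ae_eq_integral => //.
- exact: (measurable_fun_fubini_tonelli_G (fun p => (\1_B (@cons_rV R n p))%:E)).
- by move=> v _; apply: integral_ge0 => x _; rewrite lee_fin.
apply: filterS nB => v nBv _.
transitivity (\int[leb]_x (cst 0 x))%E; last exact: integral0.
apply: ge0_ae_eq_integral => //.
- exact: measurable_fun_pair1 mIc.
apply: filterS nBv => x nBx _.
by rewrite indicE memNset.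
Qed.

Lemma ae_cons_snd n (Q : 'rV[R]_n -> Prop) : {ae lebesgue_rV R n, forall v, Q v} ->
  {ae lebesgue_rV R n.+1, forall x, Q (uncons_rV x).2}.
Proof.
move=> [N [mN N0 QN]].
have mNc : measurable [set x : 'rV[R]_n.+1 | N (uncons_rV x).2].
  rewrite -[X in measurable X]setTI.
  by apply: (measurableT_comp measurable_snd (@measurable_uncons_rV R n)).
exists [set x : 'rV[R]_n.+1 | N (uncons_rV x).2]; split => //.
  apply: lebesgue_rV_null => //; exists N; split => // v /= nv.
  apply: contrapT => Nv; apply: nv; apply: aeW => x.
  by change (~ N (uncons_rV (cons_rV (x, v))).2); rewrite cons_rVK.
by move=> x /= nQ; apply: QN.
Qed.


Lemma rV_ge0_integrable n (f : 'rV[R]_n -> R) c :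
  measurable_fun [set: 'rV[R]_n] f -> (forall x, 0 <= f x) ->
  (\int[lebesgue_rV R n]_x (f x)%:E = c%:E)%E ->
  (lebesgue_rV R n).-integrable setT (EFin \o f).
Proof.
move=> mf f0 fc; apply/integrableP; split; first exact/measurable_EFinP.
by under eq_integral do rewrite /= ger0_norm//; rewrite fc ltry.
Qed.

(** The density cut off by [t <= x] is measurable jointly in the parameter, the endpoint and [t],
    and integrating out [t] preserves measurability. *)
Lemma measurable_dcdf d (T : measurableType d) (h : T -> R -> R) :
  measurable_fun [set: T * measurableTypeR R] (fun p => h p.1 p.2) ->
  (forall v x, 0 <= h v x) ->
  measurable_fun [set: T * measurableTypeR R] (fun p => dcdf (h p.1) p.2).
Proof.
move=> mh h0; rewrite /dcdf /Rintegral.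
apply: measurableT_comp => //.
pose K (q : (T * measurableTypeR R) * measurableTypeR R) : \bar R :=
  if (q.2 : R) <= q.1.2 then (h q.1.1 q.2)%:E else 0%E.
have mK : measurable_fun setT K.
  apply: measurable_fun_ifT => //.
    apply: measurable_fun_ler => //.
    exact: measurableT_comp measurable_snd measurable_fst.
  apply/measurable_EFinP.
  have m3 : measurable_fun [set: (T * measurableTypeR R) * measurableTypeR R]
      (fun q => (q.1.1, q.2)).
    apply: measurable_fun_pair => //.
    exact: measurableT_comp measurable_fst measurable_fst.
  exact: (measurableT_comp mh m3).
have K0 q : (0 <= K q)%E by rewrite /K; case: ifP => // _; rewrite lee_fin.
have := @measurable_fun_fubini_tonelli_F _ _ _ _ _ leb K mK K0.
apply: eq_measurable_fun => -[v x] _ /=.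
rewrite /fubini_F [RHS]integral_mkcond; apply: eq_integral => t _.
by rewrite patchE mem_setE /K/= in_itv/=; case: ifP.
Qed.

End knothe.

(** * The Knothe map, one coordinate at a time *)

Section knothe_map.
Context {R : realType}.
Local Notation leb := (@lebesgue_measure R).
Local Notation phi := (@normal_pdf R 0 1).
Variables a b kappa beta : R.
Hypotheses (a0 : 0 < a) (b0 : 0 < b).
Hypothesis ln_ab : forall t, 0 < t -> kappa + beta * ln t <= ln (a + b * t).

Let mphi : measurable_fun [set: R] phi := measurable_normal_pdf 0 1.

(** The first coordinate is sent by the distribution function of its conditional law given the
    others, followed by [probit]; the others go by the map of their marginal. The Jacobian of
    [a *: x + b *: u x] is then a product of diagonal derivatives and [f] a product of conditional
    and marginal densities, so [ln_ab] adds up over the coordinates. *)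
Lemma knothe_map n (f : 'rV[R]_n -> R) :
  measurable_fun [set: 'rV[R]_n] f -> (forall x, 0 <= f x) ->
  (\int[lebesgue_rV R n]_x (f x)%:E = 1)%E ->
  exists (u : 'rV[R]_n -> 'rV[R]_n) (J : 'rV[R]_n -> R),
  [/\ measurable_fun [set: 'rV[R]_n] u, measurable_fun [set: 'rV[R]_n] J,
      forall x, 0 <= J x,
      forall w, (\int[lebesgue_rV R n]_x
        (std_gaussian (a *: (w - x) - b *: u x) * J x)%:E <= 1)%E &
      {ae lebesgue_rV R n, forall x, 0 < f x -> 0 < J x /\
        n%:R * kappa + beta * (ln (f x) - ln (std_gaussian (u x))) <= ln (J x)}].
Proof.
elim: n f => [|n IH] f mf f0 f1.
  exists id, (cst 1); split => //.
  - by move=> w; rewrite integral_rV0 /std_gaussian big_ord0 mulr1.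
  - apply: aeW => x _; split => //.
    move: f1; rewrite integral_rV0 => -[f1].
    rewrite (_ : x = 0) ?f1; last by apply/rowP => -[].
    by rewrite /std_gaussian big_ord0 !ln1 mul0r subr0 mulr0 addr0.
pose fb v := (\int[leb]_x (f (cons_rV (x, v)))%:E)%E.
have mfc : measurable_fun [set: measurableTypeR R * 'rV[R]_n] (fun p => f (cons_rV p)).
  exact: measurableT_comp mf (@measurable_cons_rV R n).
have fb0 v : (0 <= fb v)%E by apply: integral_ge0 => x _; rewrite lee_fin.
have mfb : measurable_fun [set: 'rV[R]_n] fb.
  apply: (measurable_fun_fubini_tonelli_G (fun p => (f (cons_rV p))%:E)) => //.
    exact/measurable_EFinP.
  by move=> p; rewrite lee_fin.
have ifb : (\int[lebesgue_rV R n]_v fb v = 1)%E.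
  rewrite -f1 ge0_integral_cons//; exact/measurable_EFinP.
(* The marginal density may be infinite on a null set, where [fine] replaces it by 0. *)
pose g v := fine (fb v).
have mg : measurable_fun [set: 'rV[R]_n] g by exact: measurableT_comp.
have g0 v : 0 <= g v by exact: fine_ge0.
have aefb : {ae lebesgue_rV R n, forall v, fb v \is a fin_num}.
  have : (lebesgue_rV R n).-integrable setT fb.
    apply/integrableP; split => //.
    by under eq_integral do rewrite gee0_abs//; rewrite ifb ltry.
  by move=> /(integrable_ae measurableT); apply: filterS => v; exact.
have ig : (\int[lebesgue_rV R n]_v (g v)%:E = 1)%E.
  rewrite -ifb; apply: ge0_ae_eq_integral => //.
  - exact/measurable_EFinP.
  - by move=> v _; rewrite lee_fin.
  - by apply: filterS aefb => v fv _; rewrite /g fineK.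
have [u' [J' [mu' mJ' J'0 intJ' lnJ']]] := IH g mg g0 ig.
(* The conditional density of the first coordinate given [v]; as the inverse of 0 is 0, it vanishes
   where [g v = 0]. *)
pose h v x := f (cons_rV (x, v)) / g v.
have h0 v x : 0 <= h v x by rewrite divr_ge0.
have mh : measurable_fun [set: 'rV[R]_n * measurableTypeR R] (fun p => h p.1 p.2).
  have msw : measurable_fun [set: 'rV[R]_n * measurableTypeR R] (fun p => (p.2, p.1)).
    exact: measurable_fun_pair.
  apply: measurable_funM; first exact: (measurableT_comp mfc msw).
  apply: measurable_inv_ge0; first by move=> p; exact: g0.
  exact: measurableT_comp mg measurable_fst.
have mhv v : measurable_fun [set: R] (h v).
  exact: (@measurable_fun_pair2 _ _ _ _ _ _ (fun p => h p.1 p.2) v mh).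
have h1 v : 0 < g v -> (\int[leb]_x (h v x)%:E = 1)%E.
  move=> gv0; under eq_integral do rewrite /h mulrC EFinM.
  rewrite ge0_integralZl_EFin//; last 3 first.
  - by move=> x _; rewrite lee_fin.
  - by apply/measurable_EFinP; exact: measurable_fun_pair1 mfc.
  - by rewrite invr_ge0.
  have fbv : fb v \is a fin_num.
    by move: gv0; rewrite /g; case: (fb v) => [r ||] /=; rewrite ?ltxx.
  rewrite -/(fb v) -[fb v]fineK//.
  by rewrite -EFinM mulVf// gt_eqF.
have mF : measurable_fun [set: 'rV[R]_n * measurableTypeR R] (fun p => dcdf (h p.1) p.2).
  exact: measurable_dcdf.
have mc (d' : measure_display) (T : measurableType d')
    (k : 'rV[R]_n * measurableTypeR R -> T) :
    measurable_fun setT k -> measurable_fun [set: 'rV[R]_n.+1]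
      (fun x => k ((uncons_rV x).2, (uncons_rV x).1)).
  move=> mk; apply: measurableT_comp mk _; apply: measurable_fun_pair.
    exact: (measurableT_comp measurable_snd (@measurable_uncons_rV R n)).
  exact: (measurableT_comp measurable_fst (@measurable_uncons_rV R n)).
pose u0 p : R := probit (dcdf (h p.1) p.2).
pose J0 p : R := kernel_jac a b (dcdf (h p.1) p.2) (h p.1 p.2).
have mu0 : measurable_fun [set: 'rV[R]_n * measurableTypeR R] u0.
  exact: measurableT_comp (@measurable_probitT R) mF.
have mJ0 : measurable_fun [set: 'rV[R]_n * measurableTypeR R] J0.
  exact: measurable_kernel_jac.
pose sw (x : 'rV[R]_n.+1) := ((uncons_rV x).2, (uncons_rV x).1).
have swE x v : sw (cons_rV (x, v)) = (v, x) by rewrite /sw cons_rVK.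
pose u (x : 'rV[R]_n.+1) := cons_rV (u0 (sw x), u' (sw x).1).
pose J x := J0 (sw x) * J' (sw x).1.
have J00 p : 0 <= J0 p by apply: kernel_jac_ge0; [exact: ltW|exact: ltW|exact: h0].
have mu : measurable_fun [set: 'rV[R]_n.+1] u.
  apply: measurableT_comp (@measurable_cons_rV R n) _.
  apply: measurable_fun_pair; first exact: mc mu0.
  exact: mc _ _ (u' \o fst) (measurableT_comp mu' measurable_fst).
have mJ : measurable_fun [set: 'rV[R]_n.+1] J.
  apply: measurable_funM; first exact: mc mJ0.
  exact: mc _ _ (J' \o fst) (measurableT_comp mJ' measurable_fst).
have J_ge0 x : 0 <= J x by apply: mulr_ge0; [exact: J00|exact: J'0].
have lin m (w y z : 'rV[R]_m) i :
    (a *: (w - y) - b *: z) ord0 i = a * (w ord0 i - y ord0 i) - b * z ord0 i.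
  by rewrite !mxE.
exists u, J; split => //.
- move=> w; pose w0 : R := (uncons_rV w).1; pose w' := (uncons_rV w).2.
  have wE x v : a *: (w - cons_rV (x, v)) - b *: u (cons_rV (x, v)) =
      cons_rV (a * (w0 - x) - b * u0 (v, x), a *: (w' - v) - b *: u' v).
    rewrite /u swE; apply/rowP => i; rewrite lin.
    case: (unliftP ord0 i) => [j ->|->]; last by rewrite !cons_rV0.
    by rewrite !cons_rVS/= lin mxE.
  have mS : measurable_fun [set: 'rV[R]_n.+1]
      (fun x => (std_gaussian (a *: (w - x) - b *: u x) * J x)%:E).
    apply/measurable_EFinP/measurable_funM => //.
    apply: measurableT_comp (@measurable_std_gaussian R n.+1) _.
    apply/measurable_fun_rVP => i; under eq_fun do rewrite lin.
    apply: measurable_funB; apply: measurable_funM => //.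
      by apply: measurable_funB => //; exact: measurable_rV_coord.
    exact: measurableT_comp (measurable_rV_coord i) mu.
  rewrite ge0_integral_cons//; last first.
    by move=> x; rewrite lee_fin mulr_ge0 ?std_gaussian_ge0.
  apply: le_trans (intJ' w'); apply: ge0_le_integral => //.
  + by move=> v _; apply: integral_ge0 => x _; rewrite lee_fin mulr_ge0 ?std_gaussian_ge0.
  + apply: (measurable_fun_fubini_tonelli_G (fun p => (std_gaussian
      (a *: (w - cons_rV p) - b *: u (cons_rV p)) * J (cons_rV p))%:E)).
      exact: measurableT_comp mS (@measurable_cons_rV R n).
    by move=> p; rewrite lee_fin mulr_ge0 ?std_gaussian_ge0.
  + apply/measurable_EFinP/measurable_funM => //.
    apply: measurableT_comp (@measurable_std_gaussian R n) _.
    apply/measurable_fun_rVP => i; under eq_fun do rewrite lin.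
    apply: measurable_funB; apply: measurable_funM => //.
      by apply: measurable_funB => //; exact: measurable_rV_coord.
    exact: measurableT_comp (measurable_rV_coord i) mu'.
  (* On a slice the last [n] coordinates contribute the factor [C], constant in [x], and the first
     one the one-dimensional kernel. *)
  move=> v _; set C := std_gaussian _ * J' v.
  have C0 : 0 <= C by rewrite mulr_ge0 ?std_gaussian_ge0.
  have -> : (\int[leb]_x (std_gaussian (a *: (w - cons_rV (x, v)) -
      b *: u (cons_rV (x, v))) * J (cons_rV (x, v)))%:E = \int[leb]_x (C%:E *
      (phi (a * (w0 - x) - b * probit (dcdf (h v) x)) *
       kernel_jac a b (dcdf (h v) x) (h v x))%:E))%E.
    apply: eq_integral => x _.
    rewrite wE std_gaussian_cons /J swE -EFinM; congr _%:E.
    by rewrite /C /u0 /J0/=; ring.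
  have mk : measurable_fun [set: R] (fun x => (phi (a * (w0 - x) - b * probit (dcdf (h v) x)) *
       kernel_jac a b (dcdf (h v) x) (h v x))%:E).
    apply/measurable_EFinP; apply: measurable_funM; last exact: measurable_fun_pair2 mJ0.
    apply: measurableT_comp => //; apply: measurable_funB; apply: measurable_funM => //.
      exact: measurable_funB.
    exact: measurable_fun_pair2 mu0.
  rewrite ge0_integralZl_EFin//; last first.
    by move=> x _; rewrite lee_fin mulr_ge0 ?normal_pdf_ge0//; exact: (J00 (v, x)).
  rewrite -[leRHS]mule1 lee_wpmul2l ?lee_fin//.
  have [gv0|] := ltP 0 (g v).
    by apply: integral_kernel_le1 => //; [exact: h1|exact: ltW|exact: ltW].
  (* Here [h v] and its distribution function vanish, so [kernel_jac] takes its default value 0. *)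
  move=> gv0; rewrite integral0_eq// => x _.
  have hv t : h v t = 0.
    by rewrite /h (_ : g v = 0) ?invr0 ?mulr0//; apply/eqP; rewrite eq_le gv0 g0.
  rewrite /kernel_jac (_ : dcdf (h v) x = 0) ?ltxx ?mulr0//.
  by rewrite /dcdf /Rintegral integral0_eq// => t _; rewrite hv.
- pose q p : bool := [&& 0 < g p.1, 0 < dcdf (h p.1) p.2 & dcdf (h p.1) p.2 < 1].
  have mq : measurable_fun [set: 'rV[R]_n * measurableTypeR R] q.
    apply: measurable_and.
      by apply: measurable_fun_ltr => //; exact: measurableT_comp mg measurable_fst.
    by apply: measurable_and; apply: measurable_fun_ltr.
  (* The points where [f] is positive but the logarithms below are out of control. [B] is null on
     slices with [g v > 0] by [ae_dcdf_oo01], and on almost all the others because [f] integrates to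
     0 there. *)
  pose B := [set x | (0 < f x) && ~~ q (sw x)].
  have mB : measurable B.
    rewrite -[X in measurable X]setTI.
    have mb : measurable_fun [set: 'rV[R]_n.+1] (fun x => (0 < f x) && ~~ q (sw x)).
      apply: measurable_and; first exact: measurable_fun_ltr.
      by apply: measurable_neg; exact: mc mq.
    exact: (mb measurableT [set true]).
  have B0 : lebesgue_rV R n.+1 B = 0%E.
    apply: lebesgue_rV_null => //; apply: filterS aefb => v fv.
    have [gv0|] := ltP 0 (g v).
      have := ae_dcdf_oo01 (mhv v) (h0 v) (h1 v gv0).
      apply: filterS; first exact: (ae_filter_ringOfSetsType leb).
      move=> x hF; rewrite /B/= swE /q/= gv0/= => /andP[fx] /negP; apply.
      by apply: hF; rewrite /h divr_gt0.
    move=> gv0; have fbv : fb v = 0%E.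
      by rewrite -(fineK fv); congr _%:E; apply/eqP; rewrite eq_le gv0 g0.
    have f0v : (\int[leb]_x `|(f (cons_rV (x, v)))%:E| = 0)%E.
      by rewrite -fbv; apply: eq_integral => x _; rewrite gee0_abs// lee_fin.
    have mfv : measurable_fun [set: measurableTypeR R] (fun x => (f (cons_rV (x, v)))%:E).
      by apply/measurable_EFinP; exact: measurable_fun_pair1 mfc.
    have [N [mN N0 fN]] := (ae_eq_integral_abs leb measurableT mfv).1 f0v.
    exists N; split => // x /= nBx; apply: fN => /= /(_ I) [fx].
    by apply: nBx; rewrite /B/= fx ltxx.
  have aeB : {ae lebesgue_rV R n.+1, forall x, ~ B x}.
    by exists B; split => // x /= /contrapT.
  apply: filterS2 aeB (ae_cons_snd lnJ') => x nB lnx fx.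
  have : q (sw x) by apply: contrapT => nq; apply: nB; rewrite /B/= fx; exact/negP.
  have [[x0 v] xE] : exists p, x = cons_rV p by exists (uncons_rV x); rewrite uncons_rVK.
  move: lnx; rewrite {}xE in fx *; rewrite cons_rVK swE /q => /= lnv /and3P[gv0 F0 F1].
  have [J'v0 lnJ'v] := lnv gv0.
  have hp : 0 < h v x0 by rewrite divr_gt0.
  have pp : 0 < phi (u0 (v, x0)) := std_normal_gt0 _.
  have rp : 0 < h v x0 / phi (u0 (v, x0)) by rewrite divr_gt0.
  have J0E : J0 (v, x0) = a + b * (h v x0 / phi (u0 (v, x0))).
    by rewrite /J0 /kernel_jac F0 F1.
  have J0p : 0 < J0 (v, x0) by rewrite J0E addr_gt0// mulr_gt0.
  rewrite /J swE /u swE std_gaussian_cons; split; first by rewrite mulr_gt0.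
  (* [ln f - ln (std_gaussian u)] is [ln (h / phi u0)] plus the same difference for [g] and [u']:
     [ln_ab] handles the first summand, the induction hypothesis the second. *)
  have := ln_ab rp; rewrite -J0E.
  rewrite !lnM ?posrE ?invr_gt0 ?std_gaussian_gt0// !lnV ?posrE// => lnJ0.
  by move: lnJ'v lnJ0; rewrite -natr1; lra.
Qed.

End knothe_map.

(** * Comparison of integrals, and two inequalities for the logarithm *)

Section ge0_lower_bound.
Context d (T : measurableType d) (R : realType) (mu : {measure set T -> \bar R}).
Local Open Scope ereal_scope.

(** Either [L] has integral [+oo], or it is integrable and the comparison takes place off the null
    set. Allowing [+oo] matters because the entropy integral of [X + Z] is not known to be finite
    when this is applied. *)
Lemma ae_integral_le_ge0 (r L : T -> \bar R) : mu.-integrable setT r ->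
  measurable_fun setT L -> (forall x, 0 <= L x) ->
  {ae mu, forall x, r x <= L x} -> \int[mu]_x r x <= \int[mu]_x L x.
Proof.
move=> ir mL L0 [N [mN N0 rLN]].
have [->|Loo] := eqVneq (\int[mu]_x L x) +oo; first by rewrite leey.
have iL : mu.-integrable setT L.
  apply/integrableP; split => //; under eq_integral do rewrite gee0_abs//.
  by rewrite ltey.
rewrite (negligible_integral mN)// [leRHS](negligible_integral mN)//.
apply: le_integral.
- by apply: measurableD.
- by apply: integrableS ir => //; exact: measurableD.
- by apply: integrableS iL => //; exact: measurableD.
- move=> x; rewrite inE => -[_ nNx]; apply: contrapT => rL; apply: nNx.
  exact: rLN.
Qed.

End ge0_lower_bound.

Section ln_facts.
Context {R : realType}.

Lemma ln_le_subr1 (t : R) : 0 < t -> ln t <= t - 1.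
Proof.
move=> t0; have := @le_ln1Dx R (t - 1).
by rewrite (_ : 1 + (t - 1) = t); [apply; lra|ring].
Qed.

(* Concavity of [ln] at [sqrt l + sqrt (1 - l) * t =
   l * (1 / sqrt l) + (1 - l) * (t / sqrt (1 - l))]. *)
Lemma ln_sqrt_mix (l t : R) : 0 < l < 1 -> 0 < t ->
  - (l * ln l + (1 - l) * ln (1 - l)) / 2 + (1 - l) * ln t <=
  ln (Num.sqrt l + Num.sqrt (1 - l) * t).
Proof.
move=> /andP[l0 l1] t0; have m0 : 0 < 1 - l by rewrite subr_gt0.
set a := Num.sqrt l; set b := Num.sqrt (1 - l).
have a0 : 0 < a by rewrite sqrtr_gt0.
have b0 : 0 < b by rewrite sqrtr_gt0.
have aE : l = a ^+ 2 by rewrite sqr_sqrtr// ltW.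
have bE : 1 - l = b ^+ 2 by rewrite sqr_sqrtr// ltW.
have lna : ln l = 2 * ln a by rewrite aE lnXn// mulr_natl.
have lnb : ln (1 - l) = 2 * ln b by rewrite bE lnXn// mulr_natl.
set s := a + b * t.
have s0 : 0 < s by rewrite addr_gt0// mulr_gt0.
(* Jensen by hand: [ln p <= p - 1] at the two points divided by their mean [s], with weights [l] and
   [1 - l]; the right sides add up to 0. *)
have p0 : 0 < a^-1 / s by rewrite divr_gt0// invr_gt0.
have r0 : 0 < t / b / s by rewrite !divr_gt0.
have := ln_le_subr1 p0; have := ln_le_subr1 r0.
rewrite !lnM ?posrE ?invr_gt0 ?divr_gt0// !lnV ?posrE// => hr hp.
have h : a ^+ 2 * (- ln a - ln s) + b ^+ 2 * (ln t - ln b - ln s) <=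
    a ^+ 2 * (a^-1 / s - 1) + b ^+ 2 * (t / b / s - 1).
  by rewrite lerD// ler_wpM2l// sqr_ge0.
have E : a ^+ 2 * (a^-1 / s - 1) + b ^+ 2 * (t / b / s - 1) =
    1 - (a ^+ 2 + b ^+ 2).
  have sE : (a + b * t) / s = 1 by rewrite divff// gt_eqF.
  by rewrite -[in RHS]sE; field; rewrite !gt_eqF.
move: h; rewrite E -aE -bE lna lnb.
have -> : 1 - (l + (1 - l)) = 0 by ring.
nra.
Qed.

End ln_facts.

(** * Convolution of a density with the standard Gaussian *)

Section gaussian_convolution.
Context {R : realType}.
Variables (n : nat) (f : 'rV[R]_n -> R).
Hypothesis mf : measurable_fun [set: 'rV[R]_n] f.
Hypothesis f0 : forall x, 0 <= f x.
Hypothesis f1 : (\int[lebesgue_rV R n]_x (f x)%:E = 1)%E.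
Local Notation mu := (lebesgue_rV R n).
Local Notation gam := (@std_gaussian R n).
Local Notation c2pi := (Num.sqrt (2 * pi) : R).

(** For a probability density [f] the integral is at most 1, because [gam <= 1], so [fine] loses
    nothing. *)
Definition gconv (w : 'rV[R]_n) : R := fine (\int[mu]_x (f x * gam (w - x))%:E)%E.

Lemma measurable_rVB d (T : measurableType d) (u v : T -> 'rV[R]_n) :
  measurable_fun [set: T] u -> measurable_fun [set: T] v ->
  measurable_fun [set: T] (fun x => u x - v x).
Proof.
move=> mu mv; apply/measurable_fun_rVP => i; under eq_fun do rewrite !mxE.
by apply: measurable_funB; exact: measurableT_comp (measurable_rV_coord i) _.
Qed.

Lemma measurable_rVD d (T : measurableType d) (u v : T -> 'rV[R]_n) :
  measurable_fun [set: T] u -> measurable_fun [set: T] v ->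
  measurable_fun [set: T] (fun x => u x + v x).
Proof.
move=> mu mv; apply/measurable_fun_rVP => i; under eq_fun do rewrite !mxE.
by apply: measurable_funD; exact: measurableT_comp (measurable_rV_coord i) _.
Qed.

Lemma measurable_rVZ d (T : measurableType d) (a : R) (u : T -> 'rV[R]_n) :
  measurable_fun [set: T] u -> measurable_fun [set: T] (fun x => a *: u x).
Proof.
move=> mu; apply/measurable_fun_rVP => i; under eq_fun do rewrite !mxE.
by apply: measurable_funM => //; exact: measurableT_comp (measurable_rV_coord i) _.
Qed.

Lemma ge0_integral_shift (G : 'rV[R]_n -> \bar R) (x : 'rV[R]_n) :
  measurable_fun [set: 'rV[R]_n] G -> (forall y, 0 <= G y)%E ->
  (\int[mu]_z G z = \int[mu]_w G (w - x)%R)%E.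
Proof.
move=> mG G0; rewrite (@ge0_integral_affine _ _ 1 (- x))//.
by rewrite normr1 expr1n mul1e; under eq_integral do rewrite scale1r.
Qed.

Let mgam : measurable_fun [set: 'rV[R]_n] gam := @measurable_std_gaussian R n.

Let mK : measurable_fun [set: 'rV[R]_n * 'rV[R]_n]
  (fun p => (f p.1 * gam (p.2 - p.1))%:E).
Proof.
apply/measurable_EFinP; apply: measurable_funM.
  exact: measurableT_comp mf measurable_fst.
by apply: measurableT_comp mgam _; exact: measurable_rVB.
Qed.

Let K0 p : (0 <= (f p.1 * gam (p.2 - p.1))%:E)%E.
Proof. by rewrite lee_fin mulr_ge0// std_gaussian_ge0. Qed.

Let int_ge0 w : (0 <= \int[mu]_x (f x * gam (w - x))%:E)%E.
Proof. by apply: integral_ge0 => x _; exact: (K0 (x, w)). Qed.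

Let mKw w : measurable_fun [set: 'rV[R]_n] (fun x => (f x * gam (w - x))%:E).
Proof. exact: (measurable_fun_pair1 w mK). Qed.

Let int_le1 w : (\int[mu]_x (f x * gam (w - x))%:E <= 1)%E.
Proof.
rewrite -f1; apply: ge0_le_integral => //.
- by move=> x _; exact: (K0 (x, w)).
- exact/measurable_EFinP.
- by move=> x _; rewrite lee_fin ler_piMr ?std_gaussian_le1.
Qed.

Lemma gconvE w : (gconv w)%:E = (\int[mu]_x (f x * gam (w - x))%:E)%E.
Proof. by rewrite fineK// ge0_fin_numE// (le_lt_trans (int_le1 w))// ltry. Qed.

(** This gives [- ln (gconv w)] a sign, so that the entropy of [X + Z] is the integral of a
    nonnegative function. *)
Lemma gconv_le1 w : gconv w <= 1.
Proof. by rewrite -lee_fin gconvE. Qed.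

Lemma gconv_gt0 w : 0 < gconv w.
Proof.
rewrite -lte_fin gconvE lt0e int_ge0 andbT; apply/eqP => q0.
have /(ae_eq_integral_abs mu measurableT (mKw w)).1 [N [mN N0 qN]] :
    (\int[mu]_x `|(f x * gam (w - x))%:E| = 0)%E.
  by rewrite -q0; apply: eq_integral => x _; rewrite gee0_abs//; exact: (K0 (x, w)).
have : (\int[mu]_x (f x)%:E = \int[mu]_x (cst 0 x))%E.
  apply: ge0_ae_eq_integral => //; first exact/measurable_EFinP.
    by move=> x _; rewrite lee_fin.
  exists N; split => // x /= nfx; apply: qN => /= /(_ I) [/eqP].
  rewrite mulf_eq0 [X in _ || X]gt_eqF ?std_gaussian_gt0// orbF => /eqP fx.
  by apply: nfx => _; rewrite fx.
rewrite f1 integral0 => -[] /eqP; by rewrite oner_eq0.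
Qed.

Lemma measurable_gconv : measurable_fun [set: 'rV[R]_n] gconv.
Proof.
apply: measurableT_comp => //.
exact: (@measurable_fun_fubini_tonelli_G _ _ _ _ _ mu _ mK K0).
Qed.

Lemma integral_gconvM (G : 'rV[R]_n -> R) :
  measurable_fun [set: 'rV[R]_n] G -> (forall w, 0 <= G w) ->
  (\int[mu]_w (gconv w * G w)%:E =
   \int[mu]_x \int[mu]_z (f x * gam z * G (x + z))%:E)%E.
Proof.
move=> mG G0.
pose H (p : 'rV[R]_n * 'rV[R]_n) := (f p.1 * gam (p.2 - p.1) * G p.2)%:E.
have mH : measurable_fun setT H.
  rewrite /H; under eq_fun do rewrite EFinM.
  apply: emeasurable_funM => //; apply/measurable_EFinP.
  exact: measurableT_comp mG measurable_snd.
have H0 p : (0 <= H p)%E by rewrite /H EFinM mule_ge0// lee_fin.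
transitivity (\int[mu]_w \int[mu]_x H (x, w))%E.
  apply: eq_integral => w _; rewrite mulrC EFinM gconvE -ge0_integralZl_EFin//.
  - by apply: eq_integral => x _; rewrite -EFinM mulrC.
  - by move=> x _; exact: (K0 (x, w)).
rewrite -(fubini_tonelli H)//; apply: eq_integral => x _.
rewrite [RHS](ge0_integral_shift x).
- by apply: eq_integral => w _; rewrite /H/= [x + _]addrC subrK.
- apply/measurable_EFinP; apply: measurable_funM.
    exact: measurable_funM.
  apply: measurableT_comp mG _; have := measurable_affine_rV 1 x.
  by under eq_fun do rewrite scale1r addrC.
- by move=> z; rewrite lee_fin !mulr_ge0// std_gaussian_ge0.
Qed.

End gaussian_convolution.

(** * The lower bound on the entropy of the convolution *)

Section gaussian_convolution_entropy.
Context {R : realType}.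
Variables (n : nat) (f : 'rV[R]_n -> R).
Hypothesis mf : measurable_fun [set: 'rV[R]_n] f.
Hypothesis f0 : forall x, 0 <= f x.
Hypothesis f1 : (\int[lebesgue_rV R n]_x (f x)%:E = 1)%E.
Hypothesis iflnf : (lebesgue_rV R n).-integrable setT (fun x => (f x * ln (f x))%:E).
Local Notation mu := (lebesgue_rV R n).
Local Notation gam := (@std_gaussian R n).
Local Notation c2pi := (Num.sqrt (2 * pi) : R).
Local Notation q := (gconv f).

(** The pair [(a *: z - b *: u, b *: z + a *: u)] is a rotation of [(z, u)], hence has the same
    total squared norm. *)
Lemma sqnorm_rotate m (a b : R) (z u : 'rV[R]_m) : a ^+ 2 + b ^+ 2 = 1 ->
  sqnorm (a *: z - b *: u) = sqnorm z + sqnorm u - sqnorm (b *: z + a *: u).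
Proof.
move=> ab; rewrite /sqnorm -big_split/= -sumrB; apply: eq_bigr => i _.
rewrite !mxE; set y := z _ _; set w := u _ _.
by rewrite -[y ^+ 2 + _]mul1r -ab; ring.
Qed.

Let mgam : measurable_fun [set: 'rV[R]_n] gam := @measurable_std_gaussian R n.

Lemma integral_std_gaussian_quad (c A B : R) (v : 'rV[R]_n) : 0 <= B ->
  let r z := (c * gam z * (A + B * sqnorm (z + v)))%:E in
  mu.-integrable setT r /\
  (\int[mu]_z r z = (c * (A + B * (n%:R + sqnorm v)))%:E)%E.
Proof.
move=> B0 r.
have mv : measurable_fun [set: 'rV[R]_n] (fun z => sqnorm (z + v)).
  have := measurable_affine_rV 1 v; under eq_fun do rewrite scale1r.
  exact: measurableT_comp (@measurable_sqnorm R n).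
have ig : mu.-integrable setT (EFin \o gam).
  apply: (rV_ge0_integrable mgam (@std_gaussian_ge0 R n)).
  exact: integral_std_gaussian.
have iv : mu.-integrable setT (EFin \o (fun z => gam z * sqnorm (z + v))).
  apply: (rV_ge0_integrable _ _ (std_gaussian_moment2 v)).
    exact: measurable_funM.
  by move=> z; rewrite mulr_ge0 ?std_gaussian_ge0 ?sqnorm_ge0.
have rE : r = ((fun z => (c * A)%:E * (gam z)%:E) \+
    (fun z => (c * B)%:E * (gam z * sqnorm (z + v))%:E))%E.
  by apply/funext => z; rewrite /r -!EFinM -EFinD; congr _%:E; ring.
have i1 := integrableZl measurableT (c * A) ig.
have i2 := integrableZl measurableT (c * B) iv.
split; first by rewrite rE; exact: integrableD.
rewrite rE integralD// !integralZl// integral_std_gaussian std_gaussian_moment2.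
by rewrite mule1 -EFinM -EFinD; congr _%:E; ring.
Qed.

Theorem gconv_entropy_ge (l : R) : 0 < l < 1 ->
  ((l * - fine (\int[mu]_x (f x * ln (f x))%:E)%E +
    (1 - l) * (n%:R * (ln c2pi + 2^-1)) -
    n%:R * ((l * ln l + (1 - l) * ln (1 - l)) / 2))%:E <=
   \int[mu]_w (q w * - ln (q w))%:E)%E.
Proof.
move=> l01; have /andP[l0 l1] := l01; have m0 : 0 < 1 - l by rewrite subr_gt0.
set a := Num.sqrt l; set b := Num.sqrt (1 - l).
have a0 : 0 < a by rewrite sqrtr_gt0.
have b0 : 0 < b by rewrite sqrtr_gt0.
have aE : a ^+ 2 = l by rewrite sqr_sqrtr// ltW.
have bE : b ^+ 2 = 1 - l by rewrite sqr_sqrtr// ltW.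
have ab1 : a ^+ 2 + b ^+ 2 = 1 by rewrite aE bE; ring.
(* Minus half the binary entropy of [l]; [knothe_map] is applied with the constants [- kappa] and
   [1 - l]. *)
set kappa := (l * ln l + (1 - l) * ln (1 - l)) / 2.
have ln_ab t : 0 < t -> - kappa + (1 - l) * ln t <= ln (a + b * t).
  by move=> t0; have := ln_sqrt_mix l01 t0; rewrite mulNr.
have [u [J [mu' mJ J0 intJ lnJ]]] := knothe_map a0 b0 ln_ab mf f0 f1.
have mq := measurable_gconv mf f0.
have q0 w := gconv_gt0 mf f0 f1 w.
have q1 w := gconv_le1 mf f0 f1 w.
have lnq w : 0 <= - ln (q w) by rewrite oppr_ge0 ln_le0.
have mlnq : measurable_fun [set: 'rV[R]_n] (fun w => - ln (q w)).
  by apply: measurableT_comp => //; apply: measurableT_comp mq => //; exact: measurable_ln.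
rewrite integral_gconvM//.
pose S p := (f p.1 * gam p.2 * - ln (q (p.1 + p.2)))%:E.
pose k p := (q (p.1 + p.2) * (gam (a *: p.2 - b *: u p.1) * J p.1))%:E.
(* What the pointwise bound leaves after integration in [z], apart from [- l * ln (f x)]. The
   summand 1 comes from [ln t <= t - 1] and is absorbed at the end by the mass of [k];
   [n%:R * (ln c2pi + 2^-1)] is the entropy of the standard Gaussian. *)
pose C : R := 1 - n%:R * kappa + (1 - l) * (n%:R * (ln c2pi + 2^-1)).
have mS : measurable_fun [set: 'rV[R]_n * 'rV[R]_n] S.
  rewrite /S; under eq_fun do rewrite EFinM.
  apply: emeasurable_funM; apply/measurable_EFinP.
    apply: measurable_funM; first exact: measurableT_comp mf measurable_fst.
    exact: measurableT_comp mgam measurable_snd.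
  by apply: measurableT_comp mlnq _; exact: measurable_rVD.
have mk : measurable_fun [set: 'rV[R]_n * 'rV[R]_n] k.
  apply/measurable_EFinP; apply: measurable_funM.
    by apply: measurableT_comp mq _; exact: measurable_rVD.
  apply: measurable_funM; last exact: measurableT_comp mJ measurable_fst.
  apply: measurableT_comp mgam _; apply: measurable_rVB; apply: measurable_rVZ => //.
  exact: measurableT_comp mu' measurable_fst.
have S0 p : (0 <= S p)%E by rewrite lee_fin !mulr_ge0// std_gaussian_ge0.
have k0 p : (0 <= k p)%E by rewrite lee_fin mulr_ge0 ?(ltW (q0 _))// mulr_ge0// std_gaussian_ge0.
(* Substituting [w = x + z] and exchanging the integrals leaves [q w] times the kernel of
   [knothe_map], of mass at most 1 for every [w], and [q] has integral 1. *)
have intk : (\int[mu]_x \int[mu]_z k (x, z) <= 1)%E.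
  pose k' (p : 'rV[R]_n * 'rV[R]_n) :=
    (q p.2 * (gam (a *: (p.2 - p.1) - b *: u p.1) * J p.1))%:E.
  have k'0 p : (0 <= k' p)%E.
    by rewrite lee_fin mulr_ge0 ?(ltW (q0 _))// mulr_ge0// std_gaussian_ge0.
  have mk' : measurable_fun setT k'.
    apply/measurable_EFinP; apply: measurable_funM.
      exact: measurableT_comp mq measurable_snd.
    apply: measurable_funM; last exact: measurableT_comp mJ measurable_fst.
    apply: measurableT_comp mgam _; apply: measurable_rVB; apply: measurable_rVZ.
      exact: measurable_rVB.
    exact: measurableT_comp mu' measurable_fst.
  rewrite [leLHS](_ : _ = \int[mu]_x \int[mu]_w k' (x, w))%E; last first.
    apply: eq_integral => x _.
    have mkx : measurable_fun [set: 'rV[R]_n] (fun z => k (x, z)).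
      exact: measurable_fun_pair2 mk.
    rewrite (ge0_integral_shift x mkx (fun z => k0 (x, z))).
    by apply: eq_integral => w _; rewrite /k /k'/= [x + _]addrC subrK.
  rewrite (fubini_tonelli k')//.
  have -> : (1 = \int[mu]_w (q w)%:E)%E.
    under eq_integral do rewrite -[q _]mulr1.
    rewrite (integral_gconvM mf f0 f1 (G := cst 1))//.
    rewrite -f1; apply: eq_integral => x _.
    under eq_integral do rewrite mulr1 EFinM.
    rewrite ge0_integralZl_EFin//; last 2 first.
    - by move=> z _; rewrite lee_fin std_gaussian_ge0.
    - exact/measurable_EFinP.
    by rewrite integral_std_gaussian mule1.
  apply: ge0_le_integral => //.
  - by move=> w _; exact: integral_ge0.
  - exact: (@measurable_fun_fubini_tonelli_G _ _ _ _ _ mu _ mk' k'0).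
  - exact/measurable_EFinP.
  move=> w _; rewrite -[leRHS]mule1.
  apply: le_trans (lee_wpmul2l _ (intJ w)); last by rewrite lee_fin ltW.
  rewrite -ge0_integralZl_EFin//.
  - by move=> x _; rewrite lee_fin mulr_ge0// std_gaussian_ge0.
  - apply/measurable_EFinP; apply: measurable_funM => //.
    apply: measurableT_comp mgam _; apply: measurable_rVB; apply: measurable_rVZ => //.
    exact: measurable_rVB.
  - exact: ltW.
have if1 : mu.-integrable setT (EFin \o f) by exact: (rV_ge0_integrable mf f0 f1).
have irx : mu.-integrable setT (fun x => (f x * C - l * (f x * ln (f x)))%:E).
  under eq_fun do rewrite mulrC EFinB !EFinM.
  by apply: integrableB => //; exact: integrableZl.
have intrx : (\int[mu]_x (f x * C - l * (f x * ln (f x)))%:E =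
   (C - l * fine (\int[mu]_x (f x * ln (f x))%:E))%:E)%E.
  under eq_integral do rewrite mulrC EFinB !(EFinM C, EFinM l).
  rewrite integralB//; [|exact: integrableZl|exact: integrableZl].
  rewrite !integralZl// f1 mule1 EFinB EFinM fineK//.
  exact: integrable_fin_num.
(* This is [1 + ln t <= t] at [t = k / (f x * gam z)], multiplied by [f x * gam z], with [ln q]
   moved into [S], [ln J] replaced by its lower bound and the exponents rotated. Factoring out [b]
   leaves a shifted square of [z], whose Gaussian moment is known. *)
have pointwise x z : 0 < f x -> 0 < J x /\
    n%:R * - kappa + (1 - l) * (ln (f x) - ln (gam (u x))) <= ln (J x) ->
    ((f x * gam z * ((1 - n%:R * kappa - l * ln (f x) + (1 - l) * (n%:R * ln c2pi)
       - l / 2 * sqnorm (u x)) + b ^+ 2 / 2 * sqnorm (z + (a / b) *: u x)))%:E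
    <= S (x, z) + k (x, z))%E.
  move=> fx [Jx lnJx].
  have gz := std_gaussian_gt0 z; have gr := std_gaussian_gt0 (a *: z - b *: u x).
  have qx := q0 (x + z).
  have fg : 0 < f x * gam z by rewrite mulr_gt0.
  have kp : 0 < q (x + z) * (gam (a *: z - b *: u x) * J x) by rewrite !mulr_gt0.
  have := ln_le_subr1 (divr_gt0 kp fg).
  have -> : b ^+ 2 / 2 * sqnorm (z + (a / b) *: u x) = sqnorm (b *: z + a *: u x) / 2.
    have -> : b *: z + a *: u x = b *: (z + (a / b) *: u x).
      by rewrite scalerDr scalerA mulrCA divff ?mulr1// gt_eqF.
    by rewrite sqnormZ; ring.
  move: lnJx.
  rewrite !lnM ?posrE ?invr_gt0// ?mulr_gt0// lnV ?posrE// lnM ?posrE//.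
  rewrite !ln_std_gaussian (sqnorm_rotate _ _ ab1) => lnJx.
  rewrite -(ler_pM2l fg) => h; rewrite /S /k/= -EFinD lee_fin.
  have E : f x * gam z * (q (x + z) * (gam (a *: z - b *: u x) * J x) / (f x * gam z) - 1) =
      q (x + z) * (gam (a *: z - b *: u x) * J x) - f x * gam z.
    by field; rewrite !gt_eqF.
  move: h; rewrite {}E => h.
  set K := q (x + z) * (gam (a *: z - b *: u x) * J x) in h *.
  set W := f x * gam z in fg h *.
  have := ler_pM2l fg (- n%:R * kappa); nra.
have mSi := @measurable_fun_fubini_tonelli_F _ _ _ _ _ mu _ mS S0.
have mki := @measurable_fun_fubini_tonelli_F _ _ _ _ _ mu _ mk k0.
have Si0 x : (0 <= \int[mu]_z S (x, z))%E by apply: integral_ge0 => z _; exact: S0.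
have ki0 x : (0 <= \int[mu]_z k (x, z))%E by apply: integral_ge0 => z _; exact: k0.
have main : (\int[mu]_x (f x * C - l * (f x * ln (f x)))%:E <=
    \int[mu]_x (\int[mu]_z S (x, z) + \int[mu]_z k (x, z)))%E.
  apply: ae_integral_le_ge0; first exact: irx.
  - exact: emeasurable_funD mSi mki.
  - by move=> x; exact: adde_ge0.
  apply: filterS lnJ => x lnJx.
  have [fx|] := ltP 0 (f x); last first.
    move=> fx; rewrite (_ : f x = 0); last by apply/eqP; rewrite eq_le fx f0.
    by rewrite !mul0r mulr0 subr0; exact: adde_ge0.
  have mSx : measurable_fun [set: 'rV[R]_n] (fun z => S (x, z)).
    exact: measurable_fun_pair2 mS.
  have mkx : measurable_fun [set: 'rV[R]_n] (fun z => k (x, z)).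
    exact: measurable_fun_pair2 mk.
  rewrite -(ge0_integralD mu measurableT (fun z _ => S0 (x, z)) mSx
    (fun z _ => k0 (x, z)) mkx).
  have B0 : 0 <= b ^+ 2 / 2 by rewrite divr_ge0// sqr_ge0.
  (* The shift by [(a / b) *: u x] integrates to [l / 2 * sqnorm (u x)], which cancels the same term
     with a minus sign. *)
  have [ir intr] := integral_std_gaussian_quad (f x) (1 - n%:R * kappa - l * ln (f x)
    + (1 - l) * (n%:R * ln c2pi) - l / 2 * sqnorm (u x)) ((a / b) *: u x) B0.
  apply: (@le_trans _ _ (\int[mu]_z (f x * gam z * ((1 - n%:R * kappa - l * ln (f x)
    + (1 - l) * (n%:R * ln c2pi) - l / 2 * sqnorm (u x)) + b ^+ 2 / 2 *
    sqnorm (z + (a / b) *: u x)))%:E)%E).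
    rewrite intr lee_fin le_eqVlt; apply/orP; left; apply/eqP.
    rewrite sqnormZ expr_div_n aE bE /C; field.
    by rewrite gt_eqF.
  apply: ae_integral_le_ge0; first exact: ir.
  - exact: emeasurable_funD mSx mkx.
  - by move=> z; apply: adde_ge0; [exact: S0|exact: k0].
  by apply: aeW => z; apply: pointwise => //; exact: lnJx.
rewrite (ge0_integralD mu measurableT (fun x _ => Si0 x) mSi (fun x _ => ki0 x) mki) in main.
rewrite intrx in main.
have := le_trans main (leeD2l _ intk).
rewrite -leeBlDr// -EFinD; apply: le_trans; rewrite lee_fin /C; lra.
Qed.

End gaussian_convolution_entropy.

(** * Expectations and entropies expressed through densities *)

Section random_vector_densities.
Context {dO : measure_display} {Omega : measurableType dO} {R : realType}.
Variables (P : probability Omega R) (n : nat).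
Local Notation mu := (lebesgue_rV R n).
Local Notation leb := (@lebesgue_measure R).
Local Open Scope ereal_scope.

(* Layer-cake formula [g = \int_0^oo 1_(t < g) dt]. *)
Lemma expectation_density (Y : Omega -> 'rV[R]_n) f (G : 'rV[R]_n -> R) :
  measurable_fun [set: Omega] Y -> has_density P Y f ->
  measurable_fun [set: 'rV[R]_n] G -> (forall x, 0 <= G x)%R ->
  \int[P]_w (G (Y w))%:E = \int[mu]_x (f x * G x)%:E.
Proof.
move=> mY [mf f0 Yf] mG G0.
pose K (p : 'rV[R]_n * measurableTypeR R) : \bar R :=
  if (0 <= (p.2 : R))%R && ((p.2 : R) < G p.1)%R then 1 else 0.
have mGf : measurable_fun [set: 'rV[R]_n * measurableTypeR R] (fun p => G p.1).
  exact: measurableT_comp mG measurable_fst.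
have mK : measurable_fun setT K.
  apply: measurable_fun_ifT => //; apply: measurable_and.
    exact: measurable_fun_ler.
  exact: measurable_fun_ltr.
have K0 p : 0 <= K p by rewrite /K; case: ifP.
have intK x : \int[leb]_t K (x, t) = (G x)%:E.
  transitivity (\int[leb]_(t in `[0%R, G x[) cst 1 t).
    rewrite [RHS]integral_mkcond; apply: eq_integral => t _.
    by rewrite patchE mem_setE /K/= in_itv/=; case: ifP.
  rewrite integral_cst//= mul1e lebesgue_measure_itv/= lte_fin.
  case: ltP => [_|G00]; first by rewrite sube0.
  by congr _%:E; apply/eqP; rewrite eq_le G0.
pose KY (p : Omega * measurableTypeR R) := K (Y p.1, p.2).
pose fK (p : 'rV[R]_n * measurableTypeR R) := (f p.1)%:E * K p.
have mKY : measurable_fun setT KY.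
  apply: (measurableT_comp mK (f := K)); apply: measurable_fun_pair => //.
  exact: measurableT_comp mY measurable_fst.
have KY0 p : 0 <= KY p by exact: K0.
have mfK : measurable_fun setT fK.
  apply: emeasurable_funM => //; apply/measurable_EFinP.
  exact: measurableT_comp mf measurable_fst.
have fK0 p : 0 <= fK p by rewrite mule_ge0// lee_fin.
transitivity (\int[P]_w \int[leb]_t KY (w, t)).
  by apply: eq_integral => w _; rewrite -intK.
transitivity (\int[mu]_x \int[leb]_t fK (x, t)); last first.
  apply: eq_integral => x _; rewrite /fK /= EFinM -intK ge0_integralZl_EFin//.
  exact: measurable_fun_pair2 mK.
rewrite (fubini_tonelli KY)// (fubini_tonelli fK)//.
apply: eq_integral => t _; rewrite /KY /fK /=.
pose A := [set x | (0 <= (t : R))%R && ((t : R) < G x)%R].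
have mA : measurable A.
  rewrite -[X in measurable X]setTI.
  have mb : measurable_fun [set: 'rV[R]_n] (fun x => (0 <= (t : R))%R && ((t : R) < G x)%R).
    by apply: measurable_and => //; exact: measurable_fun_ltr.
  exact: (mb measurableT [set true]).
have KA x : K (x, t) = (\1_A x)%:E.
  by rewrite /K indicE /=; case: ifPn => h; [rewrite mem_set|rewrite memNset//; exact/negP].
transitivity (P (Y @^-1` A)).
  transitivity (\int[P]_w (\1_(Y @^-1` A) w)%:E).
    by apply: eq_integral => w _; rewrite KA !indicE.
  rewrite integral_indic ?setIT//.
  by rewrite -[X in measurable X]setTI; exact: mY.
rewrite Yf// integral_mkcond; apply: eq_integral => x _.
by rewrite KA patchE indicE; case: ifP => _; rewrite ?mule1 ?mule0.
Qed.

Lemma integral_has_density (Y : Omega -> 'rV[R]_n) f :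
  has_density P Y f -> \int[mu]_x (f x)%:E = 1.
Proof.
by move=> [_ _ Yf]; rewrite -Yf// preimage_setT probability_setT.
Qed.

Lemma entropyE (Y : Omega -> 'rV[R]_n) f : has_density P Y f ->
  entropy P Y = - \int[mu]_x (f x * ln (f x))%:E.
Proof.
move=> Yf; rewrite /entropy; congr (- _).
have Yg : has_density P Y (density P Y) by rewrite /density; case: xgetP => // /(_ f).
have [mg g0 gE] := Yg; have [mf f0 fE] := Yf.
have mxlnx (h : 'rV[R]_n -> R) : measurable_fun [set: 'rV[R]_n] h ->
    measurable_fun [set: 'rV[R]_n] (fun x => (h x * ln (h x))%:E).
  move=> mh; apply/measurable_EFinP/measurable_funM => //.
  exact: measurableT_comp (@measurable_ln R) mh.
apply: ae_eq_integral => //; [exact: mxlnx|exact: mxlnx|].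
have ig : mu.-integrable setT (EFin \o density P Y).
  exact: rV_ge0_integrable mg g0 (integral_has_density Yg).
have [||N [mN N0 fgN]] := integral_ae_eq measurableT ig (g := EFin \o f).
- exact/measurable_EFinP.
- by move=> E _ mE; rewrite -gE// -fE.
exists N; split => // x /= nx; apply: fgN => /= fg; apply: nx => _.
by have [->] := fg I.
Qed.

(** Independence makes the joint law a product measure, by uniqueness on rectangles; the densities
    of [Z] and [X] are then inserted in turn. *)
Lemma expectation_joint_density (X Z : {RV P >-> 'rV[R]_n}) f g
    (G : 'rV[R]_n * 'rV[R]_n -> R) : independent P X Z ->
  has_density P X f -> has_density P Z g ->
  measurable_fun setT G -> (forall p, 0 <= G p)%R ->
  \int[P]_w (G (X w, Z w))%:E = \int[mu]_x \int[mu]_z (f x * (g z * G (x, z)))%:E.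
Proof.
move=> XZ Xf Zg mG G0; have [mf f0 _] := Xf; have [mg g0 _] := Zg.
pose XZw w := (X w, Z w).
have mXZ : measurable_fun [set: Omega] XZw by exact: measurable_fun_pair.
pose m : {measure set ('rV[R]_n * 'rV[R]_n) -> \bar R} := @pushforward _ _ _ _ R P XZw.
have mE A : measurable A -> (distribution P X \x distribution P Z) A = m mXZ A.
  apply: product_measure_unique => B D mB mD /=.
  exact: XZ.
have mEG : measurable_fun [set: 'rV[R]_n * 'rV[R]_n] (EFin \o G) by exact/measurable_EFinP.
transitivity (\int[m mXZ]_p (G p)%:E).
  by rewrite (ge0_integral_pushforward mXZ)//= => p _; rewrite lee_fin.
rewrite (eq_measure_integral (distribution P X \x distribution P Z)); last first.
  by move=> A mA _; exact: esym (mE A mA).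
rewrite fubini_tonelli1//=.
pose K (p : 'rV[R]_n * 'rV[R]_n) := (g p.2 * G p)%:E.
have mK : measurable_fun setT K.
  apply/measurable_EFinP; apply: measurable_funM => //.
  exact: measurableT_comp mg measurable_snd.
have K0 p : 0 <= K p by rewrite lee_fin mulr_ge0.
have GZ x : \int[distribution P Z]_z (G (x, z))%:E = \int[mu]_z K (x, z).
  have mGx : measurable_fun [set: 'rV[R]_n] (fun z => G (x, z)).
    exact: measurable_fun_pair2 mG.
  rewrite ge0_integral_distribution//; last 2 first.
  - exact/measurable_EFinP.
  - by move=> z; rewrite lee_fin.
  exact: (expectation_density (Y := Z) (G := fun z => G (x, z))).
rewrite /fubini_F; under eq_integral do rewrite /= GZ.
rewrite ge0_integral_distribution; last 2 first.
- exact: (@measurable_fun_fubini_tonelli_F _ _ _ _ _ mu _ mK K0).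
- by move=> x; exact: integral_ge0.
pose KX (p : Omega * 'rV[R]_n) := K (X p.1, p.2).
have mKX : measurable_fun setT KX.
  apply: (measurableT_comp mK (f := K)); apply: measurable_fun_pair => //.
  exact: measurableT_comp (measurable_funPT X) measurable_fst.
have KX0 p : 0 <= KX p by exact: K0.
transitivity (\int[P]_w \int[mu]_z KX (w, z)) => //.
rewrite (fubini_tonelli KX)//.
pose fK (p : 'rV[R]_n * 'rV[R]_n) := (f p.1)%:E * K p.
have mfK : measurable_fun setT fK.
  apply: emeasurable_funM => //; apply/measurable_EFinP.
  exact: measurableT_comp mf measurable_fst.
have fK0 p : 0 <= fK p by rewrite mule_ge0// lee_fin.
transitivity (\int[mu]_x \int[mu]_z fK (x, z)); last first.
  by apply: eq_integral => x _; apply: eq_integral => z _; rewrite /fK /K /= -EFinM.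
rewrite (fubini_tonelli fK)//; apply: eq_integral => z _.
rewrite (expectation_density (Y := X) (f := f) (G := fun x => (g z * G (x, z))%R))//.
- apply: measurable_funM => //; exact: measurable_fun_pair1 mG.
- by move=> x; rewrite mulr_ge0.
Qed.

Lemma has_density_gconv (X Z : {RV P >-> 'rV[R]_n}) f : independent P X Z ->
  has_density P X f -> has_density P Z (@std_gaussian R n) ->
  has_density P (fun w => X w + Z w)%R (gconv f).
Proof.
move=> XZ Xf Zg; have [mf f0 _] := Xf; have [mg g0 _] := Zg.
have f1 := integral_has_density Xf.
split; first exact: measurable_gconv.
  by move=> w; rewrite ltW// gconv_gt0.
move=> A mA.
have mI : measurable_fun [set: 'rV[R]_n] (\1_A : _ -> R) by exact: measurable_indic.
pose G (p : 'rV[R]_n * 'rV[R]_n) : R := \1_A (p.1 + p.2)%R.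
have mXZ : measurable_fun [set: Omega] (fun w => X w + Z w)%R by exact: measurable_rVD.
transitivity (\int[P]_w (G (X w, Z w))%:E).
  have mXZA : measurable ((fun w => X w + Z w)%R @^-1` A).
    by rewrite -[X in measurable X]setTI; exact: mXZ.
  transitivity (\int[P]_w (\1_((fun w => X w + Z w)%R @^-1` A) w)%:E) => //.
  by rewrite integral_indic ?setIT.
rewrite (expectation_joint_density XZ Xf Zg)//; last first.
  apply: measurableT_comp mI _; exact: measurable_rVD.
transitivity (\int[mu]_w (gconv f w * \1_A w)%:E).
  rewrite (integral_gconvM mf f0 f1)//.
  by apply: eq_integral => x _; apply: eq_integral => z _; rewrite mulrA.
rewrite [RHS]integral_mkcond; apply: eq_integral => w _.
by rewrite patchE indicE; case: ifP => _; rewrite ?mulr1 ?mulr0.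
Qed.

End random_vector_densities.

(** Positive and negative parts are compared separately, which allows infinite integrals; [f * ln f]
    may have one for a general density. *)
Lemma le_integral_measurable d (T : measurableType d) (R : realType)
    (mu : {measure set T -> \bar R}) (f g : T -> \bar R) :
  measurable_fun [set: T] f -> measurable_fun [set: T] g ->
  (forall x, f x <= g x)%E -> (\int[mu]_x f x <= \int[mu]_x g x)%E.
Proof.
move=> mf mg fg; rewrite integralE [leRHS]integralE; apply: leeB.
  apply: ge0_le_integral => //; [exact: measurable_funepos|exact: measurable_funepos|].
  by move=> x _; rewrite !funeposE ge_max !le_max fg lexx orbT.
apply: ge0_le_integral => //; [exact: measurable_funeneg|exact: measurable_funeneg|].
by move=> x _; rewrite !funenegE ge_max !le_max leeN2 fg lexx orbT.
Qed.

(** * Comparison with Gaussian entropy *)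

Section gaussian_comparison.
Context {R : realType}.
Variable n : nat.
Local Notation mu := (lebesgue_rV R n).
Local Notation gam := (@std_gaussian R n).
Local Notation c2pi := (Num.sqrt (2 * pi) : R).

(* The log-density of N(a, r^2 I) gives an integrable minorant of [f ln f]. *)
Lemma gaussian_minorant (f : 'rV[R]_n -> R) (a : 'rV[R]_n) (r : R) :
  measurable_fun [set: 'rV[R]_n] f -> (forall x, 0 <= f x) ->
  (\int[mu]_x (f x)%:E = 1)%E -> 0 < r ->
  (\int[mu]_x (f x * sqnorm (x - a))%:E <= (n%:R * r ^+ 2)%:E)%E ->
  exists g : 'rV[R]_n -> R,
  [/\ mu.-integrable setT (EFin \o g), forall x, (g x <= f x * ln (f x))%R &
      (- (n%:R * (ln c2pi + ln r + 2^-1)))%:E <= \int[mu]_x (g x)%:E]%E.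
Proof.
move=> mf f0 f1 r0 fV.
pose h x := (r ^+ n)^-1 * gam (r^-1 *: (x - a)).
have rn0 : 0 < r ^+ n by rewrite exprn_gt0.
have h0 x : 0 < h x by rewrite mulr_gt0 ?invr_gt0// std_gaussian_gt0.
have msub : measurable_fun [set: 'rV[R]_n] (fun x => x - a) by exact: measurable_rVB.
have mh : measurable_fun [set: 'rV[R]_n] h.
  apply: measurable_funM => //; apply: measurableT_comp (@measurable_std_gaussian R n) _.
  exact: measurable_rVZ.
have h1 : (\int[mu]_x (h x)%:E = 1)%E.
  rewrite (@ge0_integral_affine R n r a) ?gt_eqF//; first last.
  - by move=> x; rewrite lee_fin ltW.
  - exact/measurable_EFinP.
  rewrite gtr0_norm// -ge0_integralZl_EFin//; last 3 first.
  - by move=> x _; rewrite lee_fin ltW.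
  - by apply/measurable_EFinP; apply: measurableT_comp mh _; exact: measurable_affine_rV.
  - exact: ltW.
  rewrite -(integral_std_gaussian n); apply: eq_integral => x _.
  rewrite /h addrK scalerA mulVf ?gt_eqF// scale1r -EFinM; congr _%:E.
  by rewrite mulrA divff ?mul1r// gt_eqF.
have fsq0 x : 0 <= f x * sqnorm (x - a) by rewrite mulr_ge0// sqnorm_ge0.
have mfsq : measurable_fun [set: 'rV[R]_n] (fun x => f x * sqnorm (x - a)).
  by apply: measurable_funM => //; exact: measurableT_comp (@measurable_sqnorm R n) msub.
pose V := fine (\int[mu]_x (f x * sqnorm (x - a))%:E)%E.
have VE : (\int[mu]_x (f x * sqnorm (x - a))%:E = V%:E)%E.
  rewrite /V fineK// ge0_fin_numE; first exact: le_lt_trans fV (ltry _).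
  by apply: integral_ge0 => x _; rewrite lee_fin.
have if_ := rV_ge0_integrable mf f0 f1.
have ih := rV_ge0_integrable mh (fun x => ltW (h0 x)) h1.
have ifsq := rV_ge0_integrable mfsq fsq0 VE.
(* [K] and [B] are chosen so that [g = f * (1 + ln h) - h], the minorant given by
   [ln (h / f) <= h / f - 1]; where [f] vanishes it equals [- h <= 0]. *)
pose K : R := 1 - n%:R * ln r - n%:R * ln c2pi.
pose B : R := - (2 * r ^+ 2)^-1.
pose g x : R := K * f x + (B * (f x * sqnorm (x - a)) + -1 * h x).
have gE : EFin \o g = ((fun x => K%:E * (f x)%:E) \+
   ((fun x => B%:E * (f x * sqnorm (x - a))%:E) \+ (fun x => (-1)%:E * (h x)%:E)))%E.
  by apply/funext => x.
have i1 := integrableZl measurableT K if_.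
have i2 := integrableZl measurableT B ifsq.
have i3 := integrableZl measurableT (-1) ih.
exists g; split.
- by rewrite gE; apply: integrableD => //; exact: integrableD.
- move=> x; have := f0 x; rewrite le_eqVlt => /predU1P[fx|fx].
    by rewrite /g -fx !(mul0r, mulr0) !add0r mulN1r oppr_le0 ltW.
  have L := ln_le_subr1 (divr_gt0 (h0 x) fx).
  rewrite lnM ?posrE ?invr_gt0// lnV ?posrE// in L.
  have lnh : ln (h x) = - (n%:R * (ln c2pi + ln r)) - (2 * r ^+ 2)^-1 * sqnorm (x - a).
    rewrite /h lnM ?posrE ?invr_gt0 ?std_gaussian_gt0// lnV ?posrE// lnXn//.
    by rewrite ln_std_gaussian sqnormZ exprVn -(mulr_natl (ln r)); field; rewrite gt_eqF.
  have E : f x * (h x / f x - 1) = h x - f x by field; rewrite gt_eqF.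
  have : f x * (ln (h x) - ln (f x)) <= h x - f x by rewrite -E ler_wpM2l.
  by rewrite lnh /g /K /B; move: (h x) => hx; nra.
have -> : (\int[mu]_x (g x)%:E = (K + (B * V + -1))%:E)%E.
  transitivity (\int[mu]_x (EFin \o g) x)%E => //.
  rewrite gE integralD//; last exact: integrableD.
  rewrite integralD// !integralZl// VE.
  by rewrite [X in (_ * X + _)%E]f1 [X in (_ + (_ + _ * X))%E]h1 !mule1.
have Vle : V <= n%:R * r ^+ 2 by rewrite -lee_fin -VE.
rewrite lee_fin /K /B.
have : (2 * r ^+ 2)^-1 * V <= n%:R * 2^-1.
  rewrite ler_pdivrMl ?mulr_gt0 ?exprn_gt0//; apply: le_trans Vle _.
  by rewrite le_eqVlt; apply/orP; left; apply/eqP; field.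
lra.
Qed.

(** The equality case of [gaussian_minorant]: the logarithm of the density is affine in [sqnorm x],
    whose moment is exactly [n * r ^+ 2]. It evaluates the entropy of [Z_X]. *)
Lemma integral_gaussian_pdf_lnM (r : R) : 0 < r ->
  let h x := gaussian_pdf 0 (r ^+ 2)%:M x : R in
  (\int[mu]_x (h x * ln (h x))%:E = (- (n%:R * (ln c2pi + ln r + 2^-1)))%:E)%E.
Proof.
move=> r0 h.
have rn0 : 0 < r ^+ n by rewrite exprn_gt0.
have hE x : h x = (r ^+ n)^-1 * gam (r^-1 *: x) by exact: gaussian_pdfE.
have lnh x : ln (h x) = - (n%:R * (ln c2pi + ln r)) - (2 * r ^+ 2)^-1 * sqnorm x.
  rewrite hE lnM ?posrE ?invr_gt0 ?std_gaussian_gt0// lnV ?posrE// lnXn//.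
  by rewrite ln_std_gaussian sqnormZ exprVn -(mulr_natl (ln r)); field; rewrite gt_eqF.
have h0 x : 0 <= h x by rewrite hE mulr_ge0 ?std_gaussian_ge0// invr_ge0 ltW.
have mh : measurable_fun [set: 'rV[R]_n] h.
  rewrite (_ : h = fun x => (r ^+ n)^-1 * gam (r^-1 *: x)); last exact/funext.
  apply: measurable_funM => //; apply: measurableT_comp (@measurable_std_gaussian R n) _.
  exact: measurable_rVZ.
have aff (G : 'rV[R]_n -> R) : measurable_fun [set: 'rV[R]_n] G -> (forall x, 0 <= G x) ->
    (\int[mu]_x (h x * G x)%:E = \int[mu]_x (gam x * G (r *: x))%:E)%E.
  move=> mG G0; rewrite (@ge0_integral_affine R n r 0) ?gt_eqF//; first last.
  - by move=> x; rewrite lee_fin mulr_ge0.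
  - by apply/measurable_EFinP; exact: measurable_funM.
  rewrite gtr0_norm// -ge0_integralZl_EFin//; last 3 first.
  - by move=> x _; rewrite lee_fin mulr_ge0.
  - apply/measurable_EFinP; apply: (measurableT_comp (f := fun x => h x * G x)).
      exact: measurable_funM.
    exact: measurable_affine_rV.
  - exact: ltW.
  apply: eq_integral => x _.
  rewrite hE addr0 scalerA mulVf ?gt_eqF// scale1r -EFinM; congr _%:E.
  by rewrite !mulrA divff ?mul1r// gt_eqF.
have h1 : (\int[mu]_x (h x)%:E = 1%:E)%E.
  have := aff (cst 1) _ (fun=> ler01); under eq_integral do rewrite mulr1.
  move=> ->//; under eq_integral do rewrite mulr1.
  exact: integral_std_gaussian.
have h2 : (\int[mu]_x (h x * sqnorm x)%:E = (n%:R * r ^+ 2)%:E)%E.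
  rewrite (aff _ (@measurable_sqnorm R n) (@sqnorm_ge0 R n)).
  under eq_integral do rewrite sqnormZ mulrCA EFinM.
  have mgs : measurable_fun [set: 'rV[R]_n] (fun x => gam x * sqnorm x).
    by apply: measurable_funM; [exact: measurable_std_gaussian|exact: measurable_sqnorm].
  rewrite ge0_integralZl_EFin//; last 3 first.
  - by move=> x _; rewrite lee_fin mulr_ge0 ?std_gaussian_ge0 ?sqnorm_ge0.
  - exact/measurable_EFinP.
  - by rewrite sqr_ge0.
  have s0 : sqnorm (0 : 'rV[R]_n) = 0.
    by rewrite /sqnorm big1// => i _; rewrite mxE expr0n.
  have := @std_gaussian_moment2 R n 0; rewrite s0 addr0 => M2.
  rewrite (_ : (\int[mu]_x (gam x * sqnorm x)%:E = n%:R%:E)%E).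
    by rewrite -EFinM mulrC.
  by rewrite -M2; apply: eq_integral => x _; rewrite addr0.
have mhs : measurable_fun [set: 'rV[R]_n] (fun x => h x * sqnorm x).
  by apply: measurable_funM => //; exact: measurable_sqnorm.
have i1 := rV_ge0_integrable mh h0 h1.
have i2 := rV_ge0_integrable mhs (fun x => mulr_ge0 (h0 x) (sqnorm_ge0 x)) h2.
pose K : R := - (n%:R * (ln c2pi + ln r)).
pose B : R := - (2 * r ^+ 2)^-1.
transitivity (\int[mu]_x (K%:E * (h x)%:E + B%:E * (h x * sqnorm x)%:E))%E.
  by apply: eq_integral => x _; rewrite lnh -!EFinM -EFinD; congr _%:E; rewrite /K /B; ring.
rewrite integralD//; [|exact: integrableZl|exact: integrableZl].
rewrite !integralZl// h1 h2 -!EFinM -EFinD; congr _%:E.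
by rewrite /K /B; field; rewrite gt_eqF.
Qed.

End gaussian_comparison.

(** * Log-concave densities are bounded and have finite entropy *)

Section log_concave_bound.
Context {R : realType}.
Variable n : nat.
Local Notation mu := (lebesgue_rV R n).

Lemma measurable_sqrt : measurable_fun [set: R] (@Num.sqrt R).
Proof. by apply: nondecreasing_measurable => // x y; exact: ler_wsqrtr. Qed.

(** Convexity at [t = 2^-1]; a value [+oo] of [phi] at [x] or [y] makes the left side 0. *)
Lemma econvex_sqrtM_le (phi : 'rV[R]_n -> \bar R) (x y : 'rV[R]_n) :
  (forall x, phi x != -oo%E) -> econvex phi ->
  Num.sqrt (fine (expeR (- phi x)%E) * fine (expeR (- phi y)%E)) <=
  fine (expeR (- phi (2^-1 *: y + 2^-1 *: x)%R)%E).
Proof.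
move=> phiNy cphi.
have h01 : 0 <= (2^-1 : R) <= 1 by apply/andP; split; lra.
have hE : 1 - 2^-1 = 2^-1 :> R by lra.
have := cphi 2^-1 y x h01; rewrite hE.
have := phiNy (2^-1 *: y + 2^-1 *: x); move: (phi (_ + _)) => p.
move: (phiNy x) (phiNy y).
case: (phi x) => [r| |] //=; last by rewrite mul0r sqrtr0 fine_ge0// expeR_ge0.
case: (phi y) => [s| |] //= _ _; last by rewrite mulr0 sqrtr0 fine_ge0// expeR_ge0.
case: p => [p| |] //= _; rewrite -!EFinM -EFinD lee_fin => ple.
rewrite -expRD (_ : - r - s = 2 * (- (2^-1 * s + 2^-1 * r))); last by field.
by rewrite expRM_natl sqrtr_sqr ger0_norm ?expR_ge0// ler_expR lerN2.
Qed.

(* Midpoint log-concavity turns [1 = \int f = 2^-n \int f((x + y) / 2) dy]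
   into [sqrt (f x) * \int (sqrt f) <= 2^n]. *)
Lemma log_concave_bounded (f : 'rV[R]_n -> R) :
  measurable_fun [set: 'rV[R]_n] f -> (forall x, 0 <= f x) ->
  (\int[mu]_x (f x)%:E = 1)%E ->
  (forall x y, Num.sqrt (f x * f y) <= f (2^-1 *: y + 2^-1 *: x)) ->
  exists C, forall x, f x <= C.
Proof.
move=> mf f0 f1 ff.
have msf : measurable_fun [set: 'rV[R]_n] (fun x => (Num.sqrt (f x))%:E).
  by apply/measurable_EFinP; exact: measurableT_comp measurable_sqrt mf.
set K := (\int[mu]_x (Num.sqrt (f x))%:E)%E.
have K0 : (0 < K)%E.
  rewrite lt0e; apply/andP; split; last first.
    by apply: integral_ge0 => x _; rewrite lee_fin sqrtr_ge0.
  apply/eqP => K0.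
  have [|N [mN N0 fN]] := (ae_eq_integral_abs mu measurableT msf).1.
    by rewrite -K0; apply: eq_integral => x _; rewrite gee0_abs// lee_fin sqrtr_ge0.
  have : (\int[mu]_x (f x)%:E = \int[mu]_x (cst 0 x))%E.
    apply: ge0_ae_eq_integral => //; first exact/measurable_EFinP.
      by move=> x _; rewrite lee_fin.
    exists N; split => // x /= nfx; apply: fN => /= /(_ I) [] /eqP.
    rewrite sqrtr_eq0 => fx; apply: nfx => _.
    by congr _%:E; apply/eqP; rewrite eq_le fx f0.
  by rewrite f1 integral0 => -[] /eqP; rewrite oner_eq0.
have key x : ((Num.sqrt (f x))%:E * K <= (2 ^+ n)%:E)%E.
  have mfx : measurable_fun [set: 'rV[R]_n] (fun y => (f (2^-1 *: y + 2^-1 *: x))%:E).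
    apply/measurable_EFinP; apply: measurableT_comp mf _.
    exact: measurable_affine_rV.
  have E : (\int[mu]_y (f (2^-1 *: y + 2^-1 *: x))%:E = (2 ^+ n)%:E)%E.
    have h0 : (2^-1 : R) != 0 by rewrite invr_neq0.
    have mEf : measurable_fun [set: 'rV[R]_n] (fun y => (f y)%:E) by exact/measurable_EFinP.
    have f0' y : (0 <= (f y)%:E)%E by rewrite lee_fin.
    have := ge0_integral_affine (2^-1 *: x) h0 mEf f0'.
    rewrite f1 ger0_norm ?invr_ge0// => e.
    rewrite -[LHS]mul1e -(_ : (2 ^+ n)%:E * (2^-1 ^+ n)%:E = 1)%E; last first.
      by rewrite -EFinM -exprMn divff// expr1n.
    by rewrite -muleA -e mule1.
  rewrite -E /K -ge0_integralZl_EFin//.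
  apply: ge0_le_integral => //.
  - exact: emeasurable_funM.
  - by move=> y _; rewrite -EFinM lee_fin -sqrtrM.
(* [K] could be [+oo] at this point; any positive real below it serves as divisor. *)
have [M [M0 MI]] : exists M : R, 0 < M /\ (M%:E <= K)%E.
  move: K0; case: (K) => [r|_|//]; last by exists 1; rewrite ltr01 leey.
  by rewrite lte_fin => r0; exists r.
exists ((2 ^+ n / M) ^+ 2) => x.
have h : Num.sqrt (f x) <= 2 ^+ n / M.
  rewrite ler_pdivlMr// -lee_fin EFinM; apply: le_trans (key x).
  by apply: lee_wpmul2l; rewrite // lee_fin sqrtr_ge0.
rewrite -(sqr_sqrtr (f0 x)) lerXn2r ?nnegrE ?sqrtr_ge0//.
by apply: le_trans h; exact: sqrtr_ge0.
Qed.

(** [f * ln f] lies between the integrable minorant of [gaussian_minorant] and [ln (C + 1) * f];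
    adding 1 to [C] makes this logarithm nonnegative. *)
Lemma bounded_xlnx_integrable (f : 'rV[R]_n -> R) (a : 'rV[R]_n) (r C : R) :
  measurable_fun [set: 'rV[R]_n] f -> (forall x, 0 <= f x) ->
  (\int[mu]_x (f x)%:E = 1)%E -> 0 < r ->
  (\int[mu]_x (f x * sqnorm (x - a))%:E <= (n%:R * r ^+ 2)%:E)%E ->
  (forall x, f x <= C) ->
  mu.-integrable setT (fun x => (f x * ln (f x))%:E).
Proof.
move=> mf f0 f1 r0 fV fC.
have [g [ig gf _]] := gaussian_minorant mf f0 f1 r0 fV.
have C0 : 0 <= C by apply: le_trans (fC 0).
pose D : R := C + 1; have D1 : 1 <= D by rewrite lerDr.
have lnD : 0 <= ln D by rewrite ln_ge0.
pose G x := `|g x| + ln D * f x.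
have iG : mu.-integrable setT (EFin \o G).
  have -> : EFin \o G = ((abse \o (EFin \o g)) \+ (fun x => (ln D)%:E * (f x)%:E))%E.
    by apply/funext.
  apply: integrableD => //; first exact: integrable_abse.
  by apply: integrableZl => //; exact: rV_ge0_integrable mf f0 f1.
apply: le_integrable iG => //.
  apply/measurable_EFinP; apply: measurable_funM => //.
  exact: measurableT_comp (@measurable_ln R) mf.
move=> x _ /=; rewrite !lee_fin [leRHS]ger0_norm; last first.
  by rewrite addr_ge0// mulr_ge0.
rewrite ler_norml; apply/andP; split.
  apply: le_trans (gf x); rewrite lerNl.
  apply: (@le_trans _ _ `|g x|); first by rewrite -normrN ler_norm.
  by rewrite lerDl mulr_ge0.
apply: (@le_trans _ _ (ln D * f x)); last by rewrite lerDr.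
rewrite mulrC; have := f0 x; rewrite le_eqVlt => /predU1P[<-|fx].
  by rewrite !mulr0.
rewrite ler_wpM2r// ler_ln ?posrE//; last exact: lt_le_trans ltr01 D1.
by apply: le_trans (fC x) _; rewrite lerDl.
Qed.

End log_concave_bound.

(** * Contractions are measurable *)

Section lipschitz_measurable.
Context {R : realType}.
Variable n : nat.

Lemma enorm_sqnorm (x : 'rV[R]_n) : enorm x = Num.sqrt (sqnorm x).
Proof. by []. Qed.

Lemma enormN (x : 'rV[R]_n) : enorm (- x) = enorm x.
Proof.
by rewrite /enorm; congr Num.sqrt; apply: eq_bigr => i _; rewrite mxE sqrrN.
Qed.

Lemma ler_norm_enorm (x : 'rV[R]_n) i : `|x ord0 i| <= enorm x.
Proof.
rewrite -sqrtr_sqr /enorm; apply: ler_wsqrtr.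
by rewrite (bigD1 i)//= lerDl; apply: sumr_ge0 => j _; exact: sqr_ge0.
Qed.

Lemma enorm_lt_dense (x : 'rV[R]_n) (e : R) : 0 < e ->
  exists v : 'rV[rat]_n, enorm (x - map_mx ratr v) < e.
Proof.
(* Coordinates within [d] give distance at most [n * d]; the successor makes this strictly less than
   [e] and covers [n = 0]. *)
move=> e0; pose d : R := e / (n.+1%:R).
have d0 : 0 < d by rewrite divr_gt0.
have ex i : exists q : rat, `|x ord0 i - ratr q| < d.
  have [|q] := @rat_in_itvoo R (x ord0 i - d) (x ord0 i + d); first by lra.
  by rewrite in_itv/= => qd; exists q; rewrite ltr_distlC; move: qd => /andP[? ?]; apply/andP; split; lra.
exists (\row_i xchoose (ex i)).
apply: (@le_lt_trans _ _ (n%:R * d)); last first.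
  rewrite /d mulrA ltr_pdivrMr// mulrC ltr_pM2l// ltr_nat//.
have nd0 : 0 <= n%:R * d by rewrite mulr_ge0// ltW.
rewrite /enorm -[leRHS](ger0_norm nd0) -sqrtr_sqr; apply: ler_wsqrtr.
apply: (@le_trans _ _ (\sum_(i < n) d ^+ 2)).
  apply: ler_sum => i _; rewrite !mxE -real_normK ?num_real//.
  by rewrite ler_sqr ?nnegrE ?normr_ge0 ?ltW//; exact: (xchooseP (ex i)).
rewrite sumr_const card_ord [leRHS]exprMn -[leLHS]mulr_natl.
apply: ler_wpM2r; first exact: sqr_ge0.
by rewrite -natrX ler_nat; case: (n) => // m; rewrite expnS leq_pmulr// expn1.
Qed.

(** The sigma-algebra is generated by the coordinates, so a countable description is used:
    coordinate [i] of [T x] is below [c] exactly when that of [T v], plus [enorm (x - v)], is below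
    [c] for some rational [v]. *)
Lemma measurable_contractive (T : 'rV[R]_n -> 'rV[R]_n) : contractive T ->
  measurable_fun [set: 'rV[R]_n] T.
Proof.
move=> cT; apply/measurable_fun_rVP => i.
have gl x y : T x ord0 i <= T y ord0 i + enorm (x - y).
  have := le_trans (ler_norm_enorm (T x - T y) i) (cT x y).
  by rewrite mul1r !mxE => /(le_trans (ler_norm _)); lra.
apply: (measurability (@RGenInftyO.G R)) => [|/= _ [_] [c] -> <-].
  exact: RGenInftyO.measurableE.
rewrite setTI [X in measurable X](_ : _ = \bigcup_(v : 'rV[rat]_n)
   [set x | T (map_mx ratr v) ord0 i + enorm (x - map_mx ratr v) < c]).
  apply: countable_bigcupT_measurable => // v.
  rewrite -[X in measurable X]setTI.
  have mb : measurable_fun [set: 'rV[R]_n]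
      (fun x => T (map_mx ratr v) ord0 i + enorm (x - map_mx ratr v) < c).
    apply: measurable_fun_ltr => //; apply: measurable_funD => //.
    apply: measurableT_comp measurable_sqrt _.
    apply: measurableT_comp (@measurable_sqnorm R n) _; exact: measurable_rVB.
  exact: (mb measurableT [set true]).
apply/seteqP; split => x /=; rewrite in_itv/=.
  move=> xc; have e0 : 0 < (c - T x ord0 i) / 2 by rewrite divr_gt0// subr_gt0.
  have [v xv] := enorm_lt_dense x e0; exists v => //=.
  have := gl (map_mx ratr v) x; rewrite -enormN opprB => Tv; lra.
by move=> [v _ /= h]; apply: le_lt_trans h; exact: gl.
Qed.

End lipschitz_measurable.

(** * Second moments and the upper bound on entropy *)

Section entropy_bounds.
Context {dO : measure_display} {Omega : measurableType dO} {R : realType}.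
Variables (P : probability Omega R) (n : nat).
Local Notation mu := (lebesgue_rV R n).
Local Notation c2pi := (Num.sqrt (2 * pi) : R).

Lemma ln_c2pi_ge0 : 0 <= ln c2pi.
Proof.
apply: ln_ge0; rewrite -[leLHS]sqrtr1 ler_sqrt; last by rewrite mulr_ge0// pi_ge0.
by have := @pi_ge2 R; lra.
Qed.

Lemma posdefmx_scalar (s : R) : (0 < n)%N -> posdefmx (s%:M : 'M[R]_n) -> 0 < s.
Proof.
case: n => // k _ [_ /(_ (delta_mx 0 0))].
have -> : (delta_mx 0 0 : 'rV[R]_k.+1) != 0.
  by apply/eqP => /rowP/(_ 0); rewrite !mxE !eqxx => /eqP; rewrite oner_eq0.
rewrite mul_mx_scalar -scalemxAl mxE trmx_delta mul_delta_mx mxE !eqxx mulr1.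
exact.
Qed.

Lemma covmx_scalar_moment (X : {RV P >-> 'rV[R]_n}) (s : R) : 0 < s ->
  covmx P X = s%:M ->
  exists m : 'rV[R]_n, (\int[P]_w (sqnorm (X w - m))%:E = (n%:R * s)%:E)%E.
Proof.
move=> s0 Xs; pose Xi i w := X w ord0 i.
have mXi i : measurable_fun [set: Omega] (Xi i).
  exact: measurableT_comp (measurable_rV_coord i) (measurable_funPT X).
pose m := \row_i fine ('E_P[Xi i])%E; exists m.
have Ei i : (\int[P]_w ((Xi i w - m ord0 i) ^+ 2)%:E = s%:E)%E.
  have covE : covariance P (Xi i) (Xi i) = (\int[P]_w ((Xi i w - m ord0 i) ^+ 2)%:E)%E.
    rewrite unlock /= unlock; apply: eq_integral => w _.
    by rewrite mxE expr2 unlock.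
  (* [fine] would send an infinite variance to 0, against [0 < s]; so the variance itself is [s]. *)
  have : fine (covariance P (Xi i) (Xi i)) = s.
    by have /matrixP/(_ i i) := Xs; rewrite !mxE eqxx mulr1n.
  rewrite covE; set e := (\int[P]_w _)%E.
  by move: s0; case: e => [r| |] /= + es; rewrite -es ?ltxx.
transitivity (\int[P]_w \sum_(i < n) ((Xi i w - m ord0 i) ^+ 2)%:E)%E.
  apply: eq_integral => w _; rewrite sumEFin /sqnorm; congr _%:E.
  by apply: eq_bigr => i _; rewrite !mxE.
rewrite ge0_integral_sum//; last 2 first.
- move=> i; apply/measurable_EFinP; apply: measurable_funX.
  exact: measurable_funB.
- by move=> i w _; rewrite lee_fin sqr_ge0.
under eq_bigr do rewrite Ei.
by rewrite sumEFin sumr_const card_ord mulr_natl.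
Qed.

(** The minorant of [gaussian_minorant] is integrated. The condition [1 <= r] makes the bound
    nonnegative, which covers a [Y] without density, whose entropy has the default value 0. *)
Lemma entropy_le_gaussian (Y : Omega -> 'rV[R]_n) (a : 'rV[R]_n) (r : R) :
  measurable_fun [set: Omega] Y -> 1 <= r ->
  (\int[P]_w (sqnorm (Y w - a))%:E <= (n%:R * r ^+ 2)%:E)%E ->
  (entropy P Y <= (n%:R * (ln c2pi + ln r + 2^-1))%:E)%E.
Proof.
move=> mY r1 YV; have r0 : 0 < r by apply: lt_le_trans r1.
have [[f Yf]|noY] := pselect (exists f, has_density P Y f); last first.
  rewrite /entropy (_ : density P Y = cst 0).
    rewrite integral0_eq ?oppe0; last by move=> x _; rewrite mul0r.
    by rewrite lee_fin mulr_ge0// !addr_ge0 ?ln_c2pi_ge0 ?ln_ge0// invr_ge0.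
  by rewrite /density; case: xgetP => // f _ Yf; case: noY; exists f.
have [mf f0 _] := Yf.
have msq : measurable_fun [set: 'rV[R]_n] (fun x => sqnorm (x - a)).
  by apply: measurableT_comp (@measurable_sqnorm R n) _; exact: measurable_rVB.
have fV : (\int[mu]_x (f x * sqnorm (x - a))%:E <= (n%:R * r ^+ 2)%:E)%E.
  by rewrite -(expectation_density mY Yf msq (fun x => sqnorm_ge0 (x - a))).
have [g [ig gf gI]] := gaussian_minorant mf f0 (integral_has_density Yf) r0 fV.
rewrite (entropyE Yf) leeNl -EFinN; apply: le_trans gI _.
apply: le_integral_measurable.
- exact: (measurable_int _ ig).
- apply/measurable_EFinP; apply: measurable_funM => //.
  exact: measurableT_comp (@measurable_ln R) mf.
- by move=> x; rewrite lee_fin.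
Qed.

(** At fixed [X = x], integrating over [Z] gives [n + sqnorm (T x - T m)], and the Lipschitz bound
    applies to the second term. The centre [T m] replaces the mean of [T(X)], since the entropy
    bound accepts any centre. *)
Lemma moment2_add_gaussian (X Z : {RV P >-> 'rV[R]_n}) (T : 'rV[R]_n -> 'rV[R]_n)
    (f : 'rV[R]_n -> R) (m : 'rV[R]_n) (L s : R) :
  independent P X Z -> has_density P X f -> has_density P Z (@std_gaussian R n) ->
  measurable_fun [set: 'rV[R]_n] T -> 0 <= L -> elipschitz L T ->
  (\int[P]_w (sqnorm (X w - m))%:E = (n%:R * s)%:E)%E ->
  (\int[P]_w (sqnorm (T (X w) + Z w - T m))%:E <= (n%:R * (1 + L ^+ 2 * s))%:E)%E.
Proof.
move=> XZ Xf Zg mT L0 LT Xs; have [mf f0 _] := Xf.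
pose G (p : 'rV[R]_n * 'rV[R]_n) : R := sqnorm (T p.1 + p.2 - T m).
have mG : measurable_fun [set: 'rV[R]_n * 'rV[R]_n] G.
  apply: measurableT_comp (@measurable_sqnorm R n) _; apply: measurable_rVB => //.
  by apply: measurable_rVD => //; exact: measurableT_comp mT measurable_fst.
rewrite (expectation_joint_density XZ Xf Zg (G := G))//; last by move=> p; exact: sqnorm_ge0.
have msq : measurable_fun [set: 'rV[R]_n] (fun x => sqnorm (x - m)).
  by apply: measurableT_comp (@measurable_sqnorm R n) _; exact: measurable_rVB.
rewrite (expectation_density (measurable_funPT X) Xf msq (fun x => sqnorm_ge0 (x - m))) in Xs.
have mfsq : measurable_fun [set: 'rV[R]_n] (fun x => f x * sqnorm (x - m)).
  exact: measurable_funM.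
apply: (@le_trans _ _ (\int[mu]_x (n%:R%:E * (f x)%:E +
    (L ^+ 2)%:E * (f x * sqnorm (x - m))%:E)))%E; last first.
  rewrite ge0_integralD//; last 4 first.
  - by move=> x _; rewrite -EFinM lee_fin mulr_ge0.
  - by apply: emeasurable_funM => //; exact/measurable_EFinP.
  - by move=> x _; rewrite -EFinM lee_fin !mulr_ge0// ?sqnorm_ge0// sqr_ge0.
  - by apply: emeasurable_funM => //; exact/measurable_EFinP.
  rewrite ge0_integralZl_EFin//; last 2 first.
  - by move=> x _; rewrite lee_fin.
  - exact/measurable_EFinP.
  rewrite ge0_integralZl_EFin//; last 3 first.
  - by move=> x _; rewrite lee_fin mulr_ge0// sqnorm_ge0.
  - exact/measurable_EFinP.
  - exact: sqr_ge0.
  rewrite Xs (integral_has_density Xf) mule1 -EFinM -EFinD lee_fin.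
  by rewrite le_eqVlt; apply/orP; left; apply/eqP; ring.
have mfG : measurable_fun [set: 'rV[R]_n * 'rV[R]_n]
    (fun p => (f p.1 * (std_gaussian p.2 * G p))%:E).
  apply/measurable_EFinP; apply: measurable_funM.
    exact: measurableT_comp mf measurable_fst.
  apply: measurable_funM => //.
  exact: measurableT_comp (@measurable_std_gaussian R n) measurable_snd.
have fG0 p : (0 <= (f p.1 * (std_gaussian p.2 * G p))%:E)%E.
  by rewrite lee_fin !mulr_ge0// ?std_gaussian_ge0// sqnorm_ge0.
apply: ge0_le_integral => //.
- by move=> x _; apply: integral_ge0 => z _; exact: (fG0 (x, z)).
- exact: (@measurable_fun_fubini_tonelli_F _ _ _ _ _ mu _ mfG fG0).
- by apply: emeasurable_funD; apply: emeasurable_funM => //; exact/measurable_EFinP.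
move=> x _.
have Ez : (\int[mu]_z (f x * (std_gaussian z * G (x, z)))%:E =
    (f x * (n%:R + sqnorm (T x - T m)))%:E)%E.
  rewrite EFinM -std_gaussian_moment2 -ge0_integralZl_EFin//.
  - apply: eq_integral => z _; rewrite -EFinM /G/=.
    by rewrite [T x + z]addrC -addrA.
  - by move=> z _; rewrite lee_fin mulr_ge0 ?std_gaussian_ge0 ?sqnorm_ge0.
  - apply/measurable_EFinP; apply: measurable_funM.
      exact: measurable_std_gaussian.
    apply: measurableT_comp (@measurable_sqnorm R n) _.
    exact: measurable_rVD.
rewrite Ez -!EFinM -EFinD lee_fin.
have hT : sqnorm (T x - T m) <= L ^+ 2 * sqnorm (x - m).
  have := LT x m; rewrite !enorm_sqnorm => h.
  rewrite -[leLHS]sqr_sqrtr ?sqnorm_ge0// -[sqnorm (x - m)]sqr_sqrtr ?sqnorm_ge0//.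
  rewrite -exprMn lerXn2r ?nnegrE ?sqrtr_ge0// mulr_ge0// sqrtr_ge0.
by have := f0 x; nra.
Qed.

End entropy_bounds.

Section lipschitz_constant.
Context {R : realType}.
Variables (n : nat) (T : 'rV[R]_n -> 'rV[R]_n).
Hypothesis cT : contractive T.

Lemma Lip_ge0 : 0 <= Lip T.
Proof. by apply: lb_le_inf; [exists 1|move=> k []]. Qed.

(** The quotient at two points at positive distance is a lower bound of the admissible constants,
    hence at most their infimum; contractivity makes 1 admissible and settles distance 0. *)
Lemma elipschitz_Lip : elipschitz (Lip T) T.
Proof.
move=> x y; have := sqrtr_ge0 (sqnorm (x - y)); rewrite -/(enorm (x - y)) le_eqVlt.
move=> /predU1P[xy0|xy].
  by have := cT x y; rewrite -xy0 !mulr0.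
rewrite -ler_pdivrMr//; apply: lb_le_inf; first by exists 1.
by move=> k [_ /(_ x y)]; rewrite ler_pdivrMr.
Qed.

End lipschitz_constant.

Theorem theorem3p4 (R : realType) (d : nat) (d_gt0 : (0 < d)%N)
    (dO dO' : measure_display)
    (Omega : measurableType dO) (Omega' : measurableType dO')
    (P : probability Omega R) (P' : probability Omega' R)
    (X Z : {RV P >-> 'rV[R]_d}) (ZX : {RV P' >-> 'rV[R]_d})
    (T : 'rV[R]_d -> 'rV[R]_d)
    (X_isotropic : isotropic P X)
    (X_log_concave : log_concave P X)
    (Z_gaussian : gaussian_vector P Z 0 1%:M)
    (XZ_independent : independent P X Z)
    (ZX_gaussian : gaussian_vector P' ZX 0 (covmx P X))
    (T_contractive : contractive T) :
  (entropy_power P (fun w => (T (X w) + Z w)%R)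
     + (1 - (expeR (entropy_gap P P' ZX X) * (Lip T)%:E) ^+ 2)
       * entropy_power P X
   <= entropy_power P (fun w => (X w + Z w)%R))%E.
Proof.
have [s Xs] := X_isotropic.
(* The covariance [s%:M] is that of the nondegenerate Gaussian [ZX], hence positive definite. *)
have s0 : 0 < s.
  by have [pd _] := ZX_gaussian; rewrite Xs in pd; exact: posdefmx_scalar pd.
have [phi [phiNy cphi Xf]] := X_log_concave.
have [mf f0 _] := Xf; have f1 := integral_has_density Xf.
set f := (fun x => fine _) in Xf mf f0 f1.
have [C fC] := log_concave_bounded mf f0 f1 (fun x y => econvex_sqrtM_le x y phiNy cphi).
have [m Xm] := covmx_scalar_moment s0 Xs.
pose r := Num.sqrt s; have r0 : 0 < r by rewrite sqrtr_gt0.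
have rE : r ^+ 2 = s by rewrite sqr_sqrtr// ltW.
have msq : measurable_fun [set: 'rV[R]_d] (fun x => sqnorm (x - m)).
  by apply: measurableT_comp (@measurable_sqnorm R d) _; exact: measurable_rVB.
have fV : (\int[lebesgue_rV R d]_x (f x * sqnorm (x - m))%:E <= (d%:R * r ^+ 2)%:E)%E.
  rewrite -(expectation_density (measurable_funPT X) Xf msq (fun x => sqnorm_ge0 (x - m))).
  by rewrite Xm rE.
have iflnf := bounded_xlnx_integrable mf f0 f1 r0 fV fC.
have Zf : has_density P Z (@std_gaussian R d).
  have [_ Zg] := Z_gaussian; rewrite (_ : @std_gaussian R d = gaussian_pdf 0 1%:M)//.
  apply/funext => x; have := @gaussian_pdfE R d 1 x ltr01.
  by rewrite !expr1n invr1 mul1r scale1r.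
pose hX := - fine (\int[lebesgue_rV R d]_x (f x * ln (f x))%:E)%E.
have XE : entropy P X = hX%:E.
  by rewrite (entropyE Xf) /hX EFinN fineK//; exact: integrable_fin_num.
pose c := ln (Num.sqrt (2 * pi) : R).
have ZXE : entropy P' ZX = (d%:R * (c + ln r + 2^-1))%:E.
  have [_ Zg] := ZX_gaussian; rewrite (entropyE Zg) Xs -rE.
  by rewrite integral_gaussian_pdf_lnM// -EFinN opprK.
have mT := measurable_contractive T_contractive.
set L := Lip T; have L0 : 0 <= L := Lip_ge0 T_contractive.
pose r' := Num.sqrt (1 + L ^+ 2 * s).
have Ls0 : 0 <= L ^+ 2 * s by rewrite mulr_ge0 ?sqr_ge0// ltW.
have r'E : r' ^+ 2 = 1 + L ^+ 2 * s by rewrite sqr_sqrtr// addr_ge0.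
have r'1 : 1 <= r' by rewrite -[leLHS]sqrtr1 ler_wsqrtr// lerDl.
have TXZle : (entropy P (fun w => T (X w) + Z w)%R <= (d%:R * (c + ln r' + 2^-1))%:E)%E.
  apply: (@entropy_le_gaussian _ _ _ P d _ (T m)) => //.
    by apply: measurable_rVD => //; exact: measurableT_comp mT (measurable_funPT X).
  rewrite r'E; apply: (moment2_add_gaussian XZ_independent Xf Zf mT L0) => //.
  exact: elipschitz_Lip.
have d0 : (d%:R : R) != 0 by rewrite pnatr_eq0 -lt0n.
have d_ge0 : 0 <= 2 / d%:R :> R by rewrite divr_ge0.
(* [A] is N(X), and [B] is 2 pi e because [c] is the logarithm of [sqrt (2 * pi)]. *)
pose A := expR (2 / d%:R * hX); pose B := expR (2 * (c + 2^-1)).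
have A0 : 0 < A := expR_gt0 _; have B0 : 0 < B := expR_gt0 _.
have AB0 : 0 < A + B by rewrite addr_gt0.
have NX : entropy_power P X = A%:E by rewrite /entropy_power XE.
have gapE : expeR (entropy_gap P P' ZX X) = (expR (d%:R^-1 * (d%:R * (c + ln r + 2^-1) - hX)))%:E.
  by rewrite /entropy_gap ZXE XE.
have NT : (entropy_power P (fun w => T (X w) + Z w)%R <= (B * (1 + L ^+ 2 * s))%:E)%E.
  apply: (@le_trans _ _ (expeR ((2 / d%:R)%:E * (d%:R * (c + ln r' + 2^-1))%:E)%E)).
    by rewrite lee_expeR; apply: lee_wpmul2l; rewrite ?lee_fin.
  rewrite -EFinM /= lee_fin -r'E le_eqVlt; apply/orP; left; apply/eqP.
  rewrite (_ : 2 / d%:R * _ = 2 * (c + 2^-1) + 2 * ln r'); last by field.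
  rewrite expRD; congr (_ * _); rewrite expRM_natl lnK// posrE.
  exact: lt_le_trans ltr01 r'1.
have NXZ : ((A + B)%:E <= entropy_power P (fun w => X w + Z w)%R)%E.
  (* As a function of [l], [l * ln A + (1 - l) * ln B] plus the binary entropy of [l] is largest
     here, with value [ln (A + B)]. *)
  pose l := A / (A + B).
  have l01 : 0 < l < 1.
    by rewrite divr_gt0//= ltr_pdivrMr// mul1r ltrDl.
  have lB : 1 - l = B / (A + B) by rewrite /l; field; rewrite gt_eqF.
  have := gconv_entropy_ge mf f0 f1 iflnf l01.
  set rhs := leRHS => H.
  have q1 w : gconv f w <= 1 := gconv_le1 mf f0 f1 w.
  have q0 w : 0 < gconv f w := gconv_gt0 mf f0 f1 w.
  have XZE : entropy P (fun w => X w + Z w)%R = rhs.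
    rewrite (entropyE (has_density_gconv XZ_independent Xf Zf)).
    (* The minus sign passes through the integral because the integrand has constant sign, even if
       the entropy is infinite. *)
    have {1}-> : (fun w => (gconv f w * ln (gconv f w))%:E) =
        (fun w => - (gconv f w * - ln (gconv f w))%:E)%E.
      by apply/funext => w; rewrite -EFinN mulrN opprK.
    have qlnq w : (0 <= (gconv f w * - ln (gconv f w))%:E)%E.
      by rewrite lee_fin mulr_ge0 ?oppr_ge0 ?ln_le0//; exact: ltW.
    by rewrite (integral_ge0N _ (fun w _ => qlnq w)) oppeK.
  rewrite /entropy_power XZE.
  apply: (@le_trans _ _ (expeR ((2 / d%:R)%:E * (l * hX + (1 - l) * (d%:R * (c + 2^-1)) -
      d%:R * ((l * ln l + (1 - l) * ln (1 - l)) / 2))%:E)%E)); last first.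
    by rewrite lee_expeR; apply: lee_wpmul2l; rewrite ?lee_fin.
  have lnA : ln A = 2 / d%:R * hX by rewrite expRK.
  have lnB : ln B = 2 * (c + 2^-1) by rewrite expRK.
  have lnl : ln l = ln A - ln (A + B) by rewrite ln_div ?posrE.
  have ln1l : ln (1 - l) = ln B - ln (A + B) by rewrite lB ln_div ?posrE.
  rewrite -EFinM /= lee_fin -[leLHS]lnK ?posrE// ler_expR le_eqVlt; apply/orP; left; apply/eqP.
  transitivity (l * ln A + (1 - l) * ln B - (l * ln l + (1 - l) * ln (1 - l))).
    by rewrite lnl ln1l; ring.
  by rewrite lnA lnB; field.
rewrite NX gapE -EFinM.
(* The terms in [L ^+ 2 * s] cancel, leaving [A + B]. *)
apply: (@le_trans _ _ ((B * (1 + L ^+ 2 * s))%:E + (A - L ^+ 2 * s * B)%:E)%E); last first.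
  by rewrite -EFinD; apply: le_trans NXZ; rewrite lee_fin; lra.
apply: leeD => //.
(* Squaring [e^Delta(X)] and multiplying by N(X) replaces [hX] by the entropy of [ZX], which gives
   [B * s]. *)
have e2 : ((expR (d%:R^-1 * (d%:R * (c + ln r + 2^-1) - hX)) * L)%:E ^+ 2 * A%:E =
    (L ^+ 2 * s * B)%:E)%E.
  rewrite -EFin_expe -EFinM; congr _%:E.
  rewrite exprMn -expRM_natl mulrAC -expRD.
  rewrite (_ : 2 * (d%:R^-1 * _) + _ = 2 * (c + 2^-1) + 2 * ln r); last by field.
  rewrite expRD -/B expRM_natl lnK ?posrE// rE; ring.
move: e2; rewrite -EFin_expe -EFinM => -[e2].
by rewrite lee_fin mulrBl mul1r e2.
Qed.
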